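(* Suppose Assumptions (A1)–(A4) hold. Let $\kappa_2,\alpha,\beta,\eta$ and $\tilde\epsilon_1,\tilde\epsilon_2,\epsilon_3,\epsilon_4,\epsilon_8,\epsilon_{11},\epsilon_{12}$ be exactly as in Theorem 3, let $\hat\epsilon\in(0,1)$ and $\breve\epsilon\in(\hat\epsilon,1)$, and let $\delta_{i,k}\in(0,\hat\epsilon^{k/2}]$ for all $i,k$. Define $\epsilon_9=\min\{\frac1{2\rho(L)},\frac{\alpha-\beta}{2\alpha}\}$, $\tilde\epsilon_{10}=\eta\min\{\tilde\epsilon_1-\eta\tilde\epsilon_2,\ \epsilon_3-\eta\epsilon_4,\ \frac\nu4\}$, $\tilde\epsilon=\tilde\epsilon_{10}/\epsilon_8$, and for $k\in\mathbb N_0$ $$\phi_k=\Big(\frac{\epsilon_{11}}{1-\tilde\epsilon}+\epsilon_{12}\Big)\cdot\begin{cases}\frac{(1-\tilde\epsilon)^{k+1}}{1-\tilde\epsilon-\hat\epsilon},&1-\tilde\epsilon>\hat\epsilon,\\ \frac{\hat\epsilon^{k+1}}{\hat\epsilon+\tilde\epsilon-1},&1-\tilde\epsilon<\hat\epsilon,\\ \frac{\breve\epsilon^{k+1}}{\breve\epsilon-\hat\epsilon},&1-\tilde\epsilon=\hat\epsilon.\end{cases}$$ Let $\{\boldsymbol x_k\}$ be generated by Algorithm 2. Then for all $k\in\mathbb N_0$, $$\|\boldsymbol x_k-\bar{\boldsymbol x}_k\|^2+n(f(\bar x_k)-f^* )\le\frac1{\epsilon_9}\big((1-\tilde\epsilon)^{k+1}\epsilon_8\hat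 U_0+\phi_k\big).$$ Moreover, if the projection $\mathcal P_{\mathbb X^*}(x)=\arg\min_{y\in\mathbb X^*}\|x-y\|^2$ is well defined for all $x$, then for all $k\in\mathbb N_0$, $$\|\boldsymbol x_k-\mathbf 1_n\otimes\mathcal P_{\mathbb X^*}(\bar x_k)\|^2\le\frac1{\epsilon_9}\Big(1+\frac1{2\nu}\Big)\big((1-\tilde\epsilon)^{k+1}\epsilon_8\hat U_0+\phi_k\big).$$
   Context: Setting as in Theorem 3: graph Laplacian $L$ ($\rho(L)$ largest, $\rho_2(L)$ smallest positive eigenvalue), $f=\frac1n\sum_if_i$, $\mathbb X^*=\arg\min f$, $f^*=\min f$. Assumptions: (A1) $\mathcal G$ connected; (A2) $\mathbb X^*\ne\emptyset$, $f^*>-\infty$; (A3) each $\nabla f_i$ is $L_f$-Lipschitz; (A4) $\frac12\|\nabla f(x)\|^2\ge\nu(f(x)-f^* )$ for all $x$ (Polyak–Łojasiewicz, $\nu>0$). Constants from Theorem 3: $\kappa_2>1$, $\kappa_3=\frac14(1+(1+8\kappa_2+\frac8{\rho_2(L)})^{1/2})$, $\tilde\kappa_1=\frac{2+9L_f^2}{2\rho_2(L)}$, $\tilde\kappa_4=6(\kappa_2+\frac1{\rho_2(L)})L_f^2+2(9(\kappa_2+\frac1{\rho_2(L)})^2L_f^4+3L_f^2)^{1/2}$; $\beta>\max\{\frac{\tilde\kappa_1}{\kappa_2-1},\kappa_3,\tilde\kappa_4\}$, $\alpha\in(\beta+\tilde\kappa_1,\kappa_2\beta]$; $\tilde\epsilon_1=(\alpha-\beta)\rho_2(L)-\frac12(2+9L_f^2)$,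 $\tilde\epsilon_2=\beta^2\rho(L)+(2\alpha^2+\beta^2)\rho^2(L)+\frac{15}2L_f^2$, $\epsilon_3=\beta-\frac12-\frac\alpha{2\beta^2}-\frac1{2\beta\rho_2(L)}$, $\epsilon_4=2\beta^2+\frac12$, $\tilde\epsilon_5=\frac18-\frac3{2\beta}(\frac1\beta+\frac1{\rho_2(L)}+\frac\alpha\beta)L_f^2$, $\tilde\epsilon_6=\frac3{\beta^2}(1+\frac1{\rho_2(L)}+\frac\alpha\beta)L_f^2+\frac{L_f(1+3L_f)}2$; $\eta\in(0,\min\{\tilde\epsilon_1/\tilde\epsilon_2,\epsilon_3/\epsilon_4,\tilde\epsilon_5/\tilde\epsilon_6\})$; $\epsilon_8=\frac{\alpha+\beta}{2\beta}+\frac1{2\rho_2(L)}$; $\epsilon_{12}=((\frac1{\beta^2}+\frac1{2\eta\beta})(\frac1{\rho_2(L)}+\frac\alpha\beta)+\frac1{2\eta\beta^2}+\frac1{\beta^2}+\frac12)\frac{3npL_f^2}4$, $\epsilon_{11}=(\frac{15\eta}4+5\eta^2)\frac{3npL_f^2}4+\epsilon_{12}$. Gradient estimator $\hat\nabla h(x,\delta)=\frac1\delta\sum_{l=1}^p(h(x+\delta e_l)-h(x))e_l$. Algorithm 2: $x_{i,0}$ arbitrary, $\sum_jv_{j,0}=\mathbf 0_p$, $x_{i,k+1}=x_{i,k}-\eta(\alpha\sum_jL_{ij}x_{j,k}+\beta v_{i,k}+\hat\nabla f_i(x_{i,k},\delta_{i,k}))$, $v_{i,k+1}=v_{i,k}+\eta\beta\sum_jL_{ij}x_{j,k}$.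 Notation: $\boldsymbol x_k=\mathrm{col}(x_{i,k})$, $\boldsymbol v_k=\mathrm{col}(v_{i,k})$, $\bar x_k=\frac1n\sum_ix_{i,k}$, $\bar{\boldsymbol x}_k=\mathbf 1_n\otimes\bar x_k$, $\boldsymbol K=(I_n-\frac1n\mathbf 1\mathbf 1^\top)\otimes I_p$, $\|z\|^2_M=z^\top Mz$, $\delta_0=\max_i\delta_{i,0}$, $\boldsymbol h^0_0=\mathrm{col}(\hat\nabla f_1(\bar x_0,\delta_0),\dots,\hat\nabla f_n(\bar x_0,\delta_0))$, $\hat U_0=\|\boldsymbol x_0\|^2_{\boldsymbol K}+\|\boldsymbol v_0+\frac1\beta\boldsymbol h^0_0\|^2_{\boldsymbol K}+n(f(\bar x_0)-f^* )$. *)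

(* Defs.v *)
From Stdlib Require Import Reals Lra Lia.
Open Scope R_scope.

(* Vectors of R^p are represented as functions nat -> R; only the
   coordinates 0..p-1 are meaningful. *)
Definition vec := nat -> R.

Fixpoint rsum (m : nat) (g : nat -> R) : R :=
  match m with
  | O => 0
  | S m' => rsum m' g + g m'
  end.

Fixpoint rmaxn (m : nat) (g : nat -> R) : R :=
  match m with
  | O => 0
  | S O => g O
  | S m' => Rmax (rmaxn m' g) (g m')
  end.

Definition dotp (p : nat) (x y : vec) : R := rsum p (fun l => x l * y l).
Definition nsq (p : nat) (x : vec) : R := rsum p (fun l => x l ^ 2).
Definition vsub (x y : vec) : vec := fun l => x l - y l.

(* f only depends on the coordinates 0..p-1, i.e. f is a function on R^p *)
Definition dep_p (p : nat) (h : vec -> R) : Prop :=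
  forall x y : vec, (forall l, (l < p)%nat -> x l = y l) -> h x = h y.

Definition is_gradient (p : nat) (h : vec -> R) (g : vec -> vec) : Prop :=
  forall x : vec, forall eps : R, eps > 0 -> exists d : R, d > 0 /\
    forall z : vec, sqrt (nsq p z) < d ->
      Rabs (h (fun l => x l + z l) - h x - dotp p (g x) z) <= eps * sqrt (nsq p z).

Definition shift (x : vec) (d : R) (l : nat) : vec :=
  fun m => if Nat.eqb m l then x m + d else x m.

Definition hatgrad (p : nat) (h : vec -> R) (x : vec) (d : R) : vec :=
  fun l => if Nat.ltb l p then (h (shift x d l) - h x) / d else 0.

Definition laplacian (n : nat) (a : nat -> nat -> R) (i j : nat) : R :=
  (if Nat.eqb i j then rsum n (fun m => a i m) else 0) - a i j.

Inductive reach (n : nat) (a : nat -> nat -> R) : nat -> nat -> Prop :=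
  | reach_refl : forall i, reach n a i i
  | reach_step : forall i j k, (j < n)%nat -> a i j > 0 -> reach n a j k -> reach n a i k.

Definition connected (n : nat) (a : nat -> nat -> R) : Prop :=
  forall i j, (i < n)%nat -> (j < n)%nat -> reach n a i j.

Definition is_eigenvalue (n : nat) (M : nat -> nat -> R) (lam : R) : Prop :=
  exists v : nat -> R, (exists i, (i < n)%nat /\ v i <> 0) /\
    forall i, (i < n)%nat -> rsum n (fun j => M i j * v j) = lam * v i.

Definition is_largest_eig (n : nat) (M : nat -> nat -> R) (r : R) : Prop :=
  is_eigenvalue n M r /\ forall mu, is_eigenvalue n M mu -> mu <= r.

Definition is_smallest_pos_eig (n : nat) (M : nat -> nat -> R) (r : R) : Prop :=
  r > 0 /\ is_eigenvalue n M r /\ forall mu, is_eigenvalue n M mu -> mu > 0 -> r <= mu.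

Definition favg (n : nat) (f : nat -> vec -> R) (x : vec) : R :=
  / INR n * rsum n (fun i => f i x).
Definition gavg (n : nat) (g : nat -> vec -> vec) (x : vec) : vec :=
  fun l => / INR n * rsum n (fun i => g i x l).

(* Stacked quantities: z : nat -> vec is col(z_1,...,z_n). *)
Definition avgv (n : nat) (z : nat -> vec) : vec :=
  fun l => / INR n * rsum n (fun i => z i l).
Definition snsq (n p : nat) (z : nat -> vec) : R := rsum n (fun i => nsq p (z i)).
(* ||z||_K^2 = z^T ((I_n - 1 1^T / n) (x) I_p) z *)
Definition Knsq (n p : nat) (z : nat -> vec) : R :=
  rsum n (fun i => rsum p (fun l => z i l * (z i l - avgv n z l))).

Definition c_kappa3 (kappa2 rho2 : R) : R :=
  / 4 * (1 + sqrt (1 + 8 * kappa2 + 8 / rho2)).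
Definition c_tkappa1 (Lf rho2 : R) : R := (2 + 9 * Lf ^ 2) / (2 * rho2).
Definition c_tkappa4 (kappa2 Lf rho2 : R) : R :=
  6 * (kappa2 + / rho2) * Lf ^ 2
  + 2 * sqrt (9 * (kappa2 + / rho2) ^ 2 * Lf ^ 4 + 3 * Lf ^ 2).
Definition c_teps1 (alpha beta Lf rho2 : R) : R :=
  (alpha - beta) * rho2 - / 2 * (2 + 9 * Lf ^ 2).
Definition c_teps2 (alpha beta Lf rho : R) : R :=
  beta ^ 2 * rho + (2 * alpha ^ 2 + beta ^ 2) * rho ^ 2 + 15 / 2 * Lf ^ 2.
Definition c_eps3 (alpha beta rho2 : R) : R :=
  beta - / 2 - alpha / (2 * beta ^ 2) - / (2 * beta * rho2).
Definition c_eps4 (beta : R) : R := 2 * beta ^ 2 + / 2.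
Definition c_teps5 (alpha beta Lf rho2 : R) : R :=
  / 8 - 3 / (2 * beta) * (/ beta + / rho2 + alpha / beta) * Lf ^ 2.
Definition c_teps6 (alpha beta Lf rho2 : R) : R :=
  3 / beta ^ 2 * (1 + / rho2 + alpha / beta) * Lf ^ 2 + Lf * (1 + 3 * Lf) / 2.
Definition c_eps8 (alpha beta rho2 : R) : R :=
  (alpha + beta) / (2 * beta) + / (2 * rho2).
Definition c_eps12 (n p : nat) (alpha beta eta Lf rho2 : R) : R :=
  ((/ beta ^ 2 + / (2 * eta * beta)) * (/ rho2 + alpha / beta)
    + / (2 * eta * beta ^ 2) + / beta ^ 2 + / 2) * (3 * INR n * INR p * Lf ^ 2 / 4).
Definition c_eps11 (n p : nat) (alpha beta eta Lf rho2 : R) : R :=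
  (15 * eta / 4 + 5 * eta ^ 2) * (3 * INR n * INR p * Lf ^ 2 / 4)
  + c_eps12 n p alpha beta eta Lf rho2.
Definition c_eps9 (alpha beta rho : R) : R := Rmin (/ (2 * rho)) ((alpha - beta) / (2 * alpha)).
Definition c_teps10 (alpha beta eta Lf rho rho2 nu : R) : R :=
  eta * Rmin (Rmin (c_teps1 alpha beta Lf rho2 - eta * c_teps2 alpha beta Lf rho)
                   (c_eps3 alpha beta rho2 - eta * c_eps4 beta))
             (nu / 4).
Definition c_teps (alpha beta eta Lf rho rho2 nu : R) : R :=
  c_teps10 alpha beta eta Lf rho rho2 nu / c_eps8 alpha beta rho2.

Definition phi (e11 e12 te he be : R) (k : nat) : R :=
  (e11 / (1 - te) + e12) *
  (if Rlt_dec he (1 - te) then (1 - te) ^ (k + 1) / (1 - te - he)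
   else if Rlt_dec (1 - te) he then he ^ (k + 1) / (he + te - 1)
   else be ^ (k + 1) / (be - he)).

Definition is_proj (p : nat) (F : vec -> R) (fstar : R) (x y : vec) : Prop :=
  F y = fstar /\ forall z, F z = fstar -> nsq p (vsub x y) <= nsq p (vsub x z).

(* Main.v *)
(** Write y, w, e, d for the centered parts of the primal variable, of the dual variable
    shifted by the scaled gradient estimates at the mean, of the error of these estimates and of
    their increment; let Q be the inverse of the Laplacian on vectors of sum zero. The quadratic
    form |y|^2/2 + w.Qw/2 + alpha |w|^2/(2 beta) + y.w, plus a multiple of the optimality gap,
    contracts by the factor 1 - te up to noise of size he^k: the algorithm gives its increment
    exactly, each cross term is bounded by Young's inequality, the smoothness of the f_i bounds
    e and d, and the Polyak-Lojasiewicz inequality turns the squared gradient into the gap.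

    A straightforward unrolling gives (1 - te)^k at time k and the quadratic-growth constant is
    2/nu. The exponent k + 1 and the constant 1/(2 nu) of the statement are reached because
    e9 |y|^2 is at most (1 - te) times the quadratic form and because the gap can be weighted by
    min (2, e8), which leaves room for 4 e9 times the gap. *)
Require Import Defs.
From Stdlib Require Import Reals Lra Lia.
Open Scope R_scope.

(** * Finite sums and quadratic forms *)

(** The spectral data are only extreme real eigenvalues, while the estimates need bounds on
    quadratic forms. Both the variational description of the least eigenvalue and the matrix [Q]
    come from one alternative, proved by elimination: a positive semidefinite matrix has a kernel or
    is solvable. Neither diagonalization nor compactness of the sphere enters. The dual variable is
    shifted by estimates taken at the mean with a radius common to all agents. Hence the shift
    changes only through the step of the mean, which the negative squared mean estimate in the
    descent inequality pays for, and through the radius, which is noise. Quadratic growth is proved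
    with discrete gradient descent in place of the gradient flow; letting the step size tend to zero
    recovers the constant 2/nu. *)

Lemma rsum_ext m u v :
  (forall i, (i < m)%nat -> u i = v i) -> rsum m u = rsum m v.
Proof.
  induction m as [|m IH]; simpl; intros H; [reflexivity|].
  rewrite IH, H; auto.
Qed.

Lemma rsum_plus m u v : rsum m (fun i => u i + v i) = rsum m u + rsum m v.
Proof. induction m as [|m IH]; simpl; [ring|]. rewrite IH; ring. Qed.

Lemma rsum_scal m c u : rsum m (fun i => c * u i) = c * rsum m u.
Proof. induction m as [|m IH]; simpl; [ring|]. rewrite IH; ring. Qed.

Lemma rsum_minus m u v : rsum m (fun i => u i - v i) = rsum m u - rsum m v.
Proof. induction m as [|m IH]; simpl; [ring|]. rewrite IH; ring. Qed.

Lemma rsum_const m c : rsum m (fun _ => c) = INR m * c.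
Proof.
  induction m as [|m IH]; [simpl; ring|].
  rewrite S_INR; simpl; rewrite IH; ring.
Qed.

Lemma rsum_le m u v :
  (forall i, (i < m)%nat -> u i <= v i) -> rsum m u <= rsum m v.
Proof.
  induction m as [|m IH]; simpl; intros H; [lra|].
  apply Rplus_le_compat; auto.
Qed.

Lemma rsum_nonneg m u : (forall i, (i < m)%nat -> 0 <= u i) -> 0 <= rsum m u.
Proof.
  intros H; replace 0 with (rsum m (fun _ => 0)) by (rewrite rsum_const; ring).
  now apply rsum_le.
Qed.

Lemma rsum_zero m u : (forall i, (i < m)%nat -> u i = 0) -> rsum m u = 0.
Proof.
  intros H; rewrite (rsum_ext m u (fun _ => 0)) by exact H.
  rewrite rsum_const; ring.
Qed.

Lemma rsum_swap m n (u : nat -> nat -> R) :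
  rsum m (fun i => rsum n (u i)) = rsum n (fun j => rsum m (fun i => u i j)).
Proof.
  induction m as [|m IH]; simpl.
  - rewrite rsum_const; ring.
  - rewrite rsum_plus, IH; reflexivity.
Qed.

Lemma rsum_term_le m u i :
  (forall j, (j < m)%nat -> 0 <= u j) -> (i < m)%nat -> u i <= rsum m u.
Proof.
  induction m as [|m IH]; intros H Hi; [lia|]; simpl.
  assert (Hm : 0 <= rsum m u) by (apply rsum_nonneg; auto).
  destruct (Nat.eq_dec i m) as [->|Hne]; [lra|].
  assert (u i <= rsum m u) by (apply IH; auto; lia).
  assert (0 <= u m) by auto; lra.
Qed.

Lemma rsum_delta m i (u : nat -> R) :
  (i < m)%nat -> rsum m (fun j => if Nat.eqb i j then u j else 0) = u i.
Proof.
  induction m as [|m IH]; intros Hi; [lia|]; simpl.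
  destruct (Nat.eq_dec i m) as [->|Hne].
  - rewrite Nat.eqb_refl, rsum_zero; [ring|].
    intros j Hj; rewrite (proj2 (Nat.eqb_neq m j)); [reflexivity|lia].
  - rewrite IH by lia; rewrite (proj2 (Nat.eqb_neq i m)) by lia; ring.
Qed.

Lemma nsq_dotp m x : nsq m x = dotp m x x.
Proof. unfold nsq, dotp; apply rsum_ext; intros; ring. Qed.

Lemma nsq_nonneg m x : 0 <= nsq m x.
Proof. unfold nsq; apply rsum_nonneg; intros; apply pow2_ge_0. Qed.

Lemma nsq_ext m x y :
  (forall i, (i < m)%nat -> x i = y i) -> nsq m x = nsq m y.
Proof. intros H; unfold nsq; apply rsum_ext; intros; rewrite H; auto. Qed.

Lemma dotp_ext m x x' y y' :
  (forall i, (i < m)%nat -> x i = x' i) -> (forall i, (i < m)%nat -> y i = y' i) ->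
  dotp m x y = dotp m x' y'.
Proof.
  intros Hx Hy; unfold dotp; apply rsum_ext; intros.
  rewrite Hx, Hy; auto.
Qed.

Lemma dotp_sym m x y : dotp m x y = dotp m y x.
Proof. unfold dotp; apply rsum_ext; intros; ring. Qed.

Lemma nsq_eq0 m x i : nsq m x = 0 -> (i < m)%nat -> x i = 0.
Proof.
  intros H Hi.
  assert (x i ^ 2 <= 0).
  { rewrite <- H; unfold nsq.
    apply (rsum_term_le m (fun l => x l ^ 2)); auto.
    intros; apply pow2_ge_0. }
  nra.
Qed.

Lemma nsq_pos m x i : (i < m)%nat -> x i <> 0 -> 0 < nsq m x.
Proof.
  intros Hi Hx; destruct (Rle_lt_or_eq_dec _ _ (nsq_nonneg m x)) as [H|H]; auto.
  exfalso; apply Hx, (nsq_eq0 m); auto.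
Qed.

Lemma nsq_pos_inv m x : 0 < nsq m x -> exists i, (i < m)%nat /\ x i <> 0.
Proof.
  unfold nsq; induction m as [|m IH]; cbn [rsum]; intros H; [lra|].
  destruct (Req_dec (x m) 0) as [E|E].
  - destruct IH as [i [Hi Hxi]]; [rewrite E in H; nra|].
    exists i; split; auto; lia.
  - exists m; split; auto.
Qed.

Lemma dotp_young m c x y :
  0 < c -> dotp m x y <= c / 2 * nsq m x + / (2 * c) * nsq m y.
Proof.
  intros Hc; unfold dotp, nsq.
  rewrite <- !rsum_scal, <- rsum_plus; apply rsum_le; intros i _.
  assert (H : c / 2 * x i ^ 2 + / (2 * c) * y i ^ 2 - x i * y i
              = / (2 * c) * (c * x i - y i) ^ 2) by (field; lra).
  assert (0 <= / (2 * c) * (c * x i - y i) ^ 2).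
  { apply Rmult_le_pos; [left; apply Rinv_0_lt_compat; lra|apply pow2_ge_0]. }
  lra.
Qed.

(** * Matrix action and positive semidefinite forms *)

Definition mv (m : nat) (A : nat -> nat -> R) (x : nat -> R) : nat -> R :=
  fun i => rsum m (fun j => A i j * x j).

Definition symmetric (m : nat) (A : nat -> nat -> R) : Prop :=
  forall i j, (i < m)%nat -> (j < m)%nat -> A i j = A j i.

Definition psd (m : nat) (A : nat -> nat -> R) : Prop :=
  forall x, 0 <= dotp m x (mv m A x).

Lemma mv_ext m A x y i :
  (forall j, (j < m)%nat -> x j = y j) -> mv m A x i = mv m A y i.
Proof. intros H; unfold mv; apply rsum_ext; intros; rewrite H; auto. Qed.

Lemma mv_plus m A x y i : mv m A (fun j => x j + y j) i = mv m A x i + mv m A y i.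
Proof. unfold mv; rewrite <- rsum_plus; apply rsum_ext; intros; ring. Qed.

Lemma mv_scal m A c x i : mv m A (fun j => c * x j) i = c * mv m A x i.
Proof. unfold mv; rewrite <- rsum_scal; apply rsum_ext; intros; ring. Qed.

Lemma mv_symm m A x y :
  symmetric m A -> dotp m x (mv m A y) = dotp m y (mv m A x).
Proof.
  intros HA; unfold dotp, mv.
  rewrite (rsum_ext m _ (fun l => rsum m (fun j => x l * (A l j * y j))))
    by (intros; rewrite rsum_scal; reflexivity).
  rewrite rsum_swap; apply rsum_ext; intros i Hi.
  rewrite <- rsum_scal; apply rsum_ext; intros j Hj.
  rewrite (HA j i) by auto; ring.
Qed.

Lemma dotp_plus_l m x y z : dotp m (fun i => x i + y i) z = dotp m x z + dotp m y z.
Proof. unfold dotp; rewrite <- rsum_plus; apply rsum_ext; intros; ring. Qed.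

Lemma dotp_plus_r m x y z : dotp m z (fun i => x i + y i) = dotp m z x + dotp m z y.
Proof. unfold dotp; rewrite <- rsum_plus; apply rsum_ext; intros; ring. Qed.

Lemma dotp_scal_l m c x z : dotp m (fun i => c * x i) z = c * dotp m x z.
Proof. unfold dotp; rewrite <- rsum_scal; apply rsum_ext; intros; ring. Qed.

Lemma dotp_scal_r m c x z : dotp m z (fun i => c * x i) = c * dotp m z x.
Proof. unfold dotp; rewrite <- rsum_scal; apply rsum_ext; intros; ring. Qed.

(** The form is evaluated at [x + s y], and symmetry merges the two cross terms. Choosing [s] yields
    every weighted Young inequality for [A]. *)
Lemma psd_quad m A x y s :
  symmetric m A -> psd m A ->
  0 <= dotp m x (mv m A x) + 2 * s * dotp m x (mv m A y) + s ^ 2 * dotp m y (mv m A y).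
Proof.
  intros HA HP; pose proof (HP (fun i => x i + s * y i)) as H.
  rewrite (dotp_ext m _ (fun i => x i + s * y i) (mv m A (fun i => x i + s * y i))
             (fun i => mv m A x i + s * mv m A y i)) in H; auto.
  2:{ intros i _; rewrite mv_plus, mv_scal; reflexivity. }
  rewrite dotp_plus_l, dotp_scal_l, !dotp_plus_r, !dotp_scal_r in H.
  rewrite (mv_symm m A y x HA) in H; nra.
Qed.

Lemma psd_young m A x y c :
  symmetric m A -> psd m A -> 0 < c ->
  dotp m x (mv m A y) <= c / 2 * dotp m x (mv m A x) + / (2 * c) * dotp m y (mv m A y).
Proof.
  intros HA HP Hc; pose proof (psd_quad m A x y (- / c) HA HP) as H.
  assert (E : c / 2 * dotp m x (mv m A x) + / (2 * c) * dotp m y (mv m A y)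
     - dotp m x (mv m A y) = c / 2 * (dotp m x (mv m A x)
         + 2 * - / c * dotp m x (mv m A y) + (- / c) ^ 2 * dotp m y (mv m A y)))
    by (field; lra).
  assert (0 <= c / 2 * (dotp m x (mv m A x)
         + 2 * - / c * dotp m x (mv m A y) + (- / c) ^ 2 * dotp m y (mv m A y)))
    by (apply Rmult_le_pos; lra).
  lra.
Qed.

(** * Extremal eigenvalues of symmetric matrices *)

Definition basis (j : nat) : nat -> R := fun i => if Nat.eqb j i then 1 else 0.

Lemma mv_basis m A j i : (j < m)%nat -> mv m A (basis j) i = A i j.
Proof.
  intros Hj; unfold mv, basis.
  rewrite (rsum_ext m _ (fun k => if Nat.eqb j k then A i k else 0)).
  - apply (rsum_delta m j (A i)); auto.
  - intros k _; destruct (Nat.eqb j k); ring.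
Qed.

Lemma dotp_basis m j x : (j < m)%nat -> dotp m (basis j) x = x j.
Proof.
  intros Hj; rewrite <- (rsum_delta m j x Hj); unfold dotp, basis.
  apply rsum_ext; intros k _; destruct (Nat.eqb j k); ring.
Qed.

Definition snoc (m : nat) (x : nat -> R) (c : R) : nat -> R :=
  fun i => if Nat.ltb i m then x i else c.

Lemma snoc_lt m x c i : (i < m)%nat -> snoc m x c i = x i.
Proof. intros H; unfold snoc; now rewrite (proj2 (Nat.ltb_lt i m) H). Qed.

Lemma snoc_last m x c : snoc m x c m = c.
Proof. unfold snoc; now rewrite Nat.ltb_irrefl. Qed.

Lemma mv_snoc m A x c i : mv (S m) A (snoc m x c) i = mv m A x i + A i m * c.
Proof.
  unfold mv; cbn [rsum]; rewrite snoc_last; f_equal.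
  apply rsum_ext; intros j Hj; now rewrite snoc_lt.
Qed.

Definition schur (m : nat) (A : nat -> nat -> R) (i j : nat) : R :=
  A i j - A i m * / A m m * A m j.

(** The last coordinate is chosen so that row [m] of [A] annihilates the extended vector; on the
    other rows its elimination leaves the Schur complement. *)
Lemma mv_schur m A x i :
  A m m <> 0 ->
  mv m (schur m A) x i = mv (S m) A (snoc m x (- / A m m * mv m A x m)) i.
Proof.
  intros Hp; rewrite mv_snoc; unfold mv, schur.
  rewrite (rsum_ext m _ (fun j => A i j * x j - A i m * / A m m * (A m j * x j)))
    by (intros; ring).
  rewrite rsum_minus, rsum_scal; ring.
Qed.

Lemma psd_schur m A : A m m <> 0 -> psd (S m) A -> psd m (schur m A).
Proof.
  intros Hp HP x; pose proof (HP (snoc m x (- / A m m * mv m A x m))) as H.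
  replace (dotp m x (mv m (schur m A) x)) with
    (dotp (S m) (snoc m x (- / A m m * mv m A x m))
       (mv (S m) A (snoc m x (- / A m m * mv m A x m)))); [exact H|].
  unfold dotp at 1; cbn [rsum]; rewrite snoc_last.
  rewrite (mv_snoc m A _ _ m).
  replace (mv m A x m + A m m * (- / A m m * mv m A x m)) with 0 by (field; auto).
  rewrite Rmult_0_r, Rplus_0_r; apply rsum_ext; intros i Hi.
  rewrite snoc_lt by auto; rewrite mv_schur; auto.
Qed.

Lemma symmetric_schur m A : symmetric (S m) A -> symmetric m (schur m A).
Proof.
  intros H i j Hi Hj; unfold schur.
  rewrite (H i j), (H i m), (H m j) by lia; ring.
Qed.

(** Elimination of the last variable. A positive pivot reduces both alternatives to the Schur
    complement, which is again positive semidefinite. A zero pivot forces its whole row and column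
    to vanish, so the last basis vector lies in the kernel. *)
Lemma psd_kernel_or_solvable m A :
  symmetric m A -> psd m A ->
  (exists x, 0 < nsq m x /\ forall i, (i < m)%nat -> mv m A x i = 0) \/
  (forall b, exists x, forall i, (i < m)%nat -> mv m A x i = b i).
Proof.
  revert A; induction m as [|m IH]; intros A HA HP.
  { right; intros b; exists b; intros; lia. }
  assert (Hp : 0 <= A m m).
  { pose proof (HP (basis m)) as H.
    rewrite dotp_basis, mv_basis in H by lia; lra. }
  destruct (Rle_lt_or_eq_dec _ _ Hp) as [Hpos|Hz].
  - assert (Hne : A m m <> 0) by lra.
    destruct (IH (schur m A)) as [[x [Hx Hk]]|Hs].
    + now apply symmetric_schur.
    + now apply psd_schur.
    + left; exists (snoc m x (- / A m m * mv m A x m)); split.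
      * unfold nsq; cbn [rsum].
        rewrite (rsum_ext m _ (fun l => x l ^ 2))
          by (intros; rewrite snoc_lt; auto).
        fold (nsq m x).
        pose proof (pow2_ge_0 (snoc m x (- / A m m * mv m A x m) m)); lra.
      * intros i Hi; destruct (Nat.eq_dec i m) as [->|Hi'].
        -- rewrite mv_snoc; field; auto.
        -- rewrite <- mv_schur by auto; apply Hk; lia.
    + right; intros b.
      destruct (Hs (fun i => b i - A i m * / A m m * b m)) as [x Hx].
      exists (snoc m x (- / A m m * mv m A x m + / A m m * b m)); intros i Hi.
      rewrite mv_snoc; destruct (Nat.eq_dec i m) as [->|Hi'].
      * field; auto.
      * assert (Hi2 : (i < m)%nat) by lia; specialize (Hx i Hi2).
        rewrite mv_schur, mv_snoc in Hx by auto; lra.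
  - left; exists (basis m); split.
    + apply (nsq_pos _ _ m); [lia|]; unfold basis; rewrite Nat.eqb_refl; lra.
    + intros i Hi; rewrite mv_basis by lia.
      destruct (Nat.eq_dec i m) as [->|Hi']; [lra|].
      (* With a zero pivot the form at [basis m + s basis i] has no constant term, so a nonzero
         linear term would make it negative for small [s] of the right sign. *)
      assert (Hq : forall s, 0 <= 2 * s * A m i + s ^ 2 * A i i).
      { intros s; pose proof (psd_quad (S m) A (basis m) (basis i) s HA HP) as H.
        rewrite !dotp_basis, !mv_basis in H by lia; lra. }
      rewrite (HA i m) by lia.
      assert (Hii : 0 <= A i i) by (pose proof (Hq 1); pose proof (Hq (-1)); nra).
      (* Nearly the minimizing [s]; the added 1 keeps the denominator positive when [A i i] is
         zero. *)
      pose proof (Hq (- A m i / (A i i + 1))) as H.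
      assert (E : 2 * (- A m i / (A i i + 1)) * A m i
          + (- A m i / (A i i + 1)) ^ 2 * A i i
          = - (A m i * / (A i i + 1)) ^ 2 * (A i i + 2)) by (field; lra).
      rewrite E in H.
      assert (Hz2 : A m i * / (A i i + 1) = 0).
      { pose proof (pow2_ge_0 (A m i * / (A i i + 1))); nra. }
      apply Rmult_integral in Hz2; destruct Hz2 as [Hz2|Hz2]; auto.
      pose proof (Rinv_0_lt_compat (A i i + 1)); lra.
Qed.

(** Over a finite range the choice function is built index by index, without a choice axiom; [d] is
    its value outside the range. *)
Lemma finite_choice (T : Type) (d : T) (P : nat -> T -> Prop) m :
  (forall j, (j < m)%nat -> exists x, P j x) ->
  exists F, forall j, (j < m)%nat -> P j (F j).
Proof.
  induction m as [|m IH]; intros H.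
  - exists (fun _ => d); intros; lia.
  - destruct IH as [F HF]; [intros; apply H; lia|].
    destruct (H m) as [x Hx]; [lia|].
    exists (fun j => if Nat.eqb j m then x else F j); intros j Hj.
    destruct (Nat.eqb_spec j m) as [->|Hne]; auto; apply HF; lia.
Qed.

Lemma right_inverse_of_solvable m A :
  (forall b, exists x, forall i, (i < m)%nat -> mv m A x i = b i) ->
  exists B, forall b i, (i < m)%nat -> mv m A (mv m B b) i = b i.
Proof.
  intros H.
  destruct (finite_choice _ (fun _ : nat => 0)
    (fun j x => forall i, (i < m)%nat -> mv m A x i = basis j i) m) as [F HF].
  { intros j _; apply H. }
  exists (fun i j => F j i); intros b i Hi; unfold mv.
  rewrite (rsum_ext m _ (fun j => rsum m (fun k => b k * (A i j * F k j)))).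
  2:{ intros j _; rewrite <- rsum_scal; apply rsum_ext; intros; ring. }
  rewrite rsum_swap, <- (rsum_delta m i b Hi); apply rsum_ext; intros k Hk.
  rewrite rsum_scal; pose proof (HF k Hk i Hi) as E; unfold mv in E; rewrite E.
  unfold basis; rewrite Nat.eqb_sym; destruct (Nat.eqb i k); ring.
Qed.

Lemma quad_form_bound m A :
  exists C, 0 < C /\ forall x, Rabs (dotp m x (mv m A x)) <= C * nsq m x.
Proof.
  set (S := rsum m (fun i => rsum m (fun j => Rabs (A i j)))).
  assert (HS : 0 <= S).
  { apply rsum_nonneg; intros; apply rsum_nonneg; intros; apply Rabs_pos. }
  exists (S + 1); split; [lra|]; intros x.
  assert (Hx := nsq_nonneg m x).
  assert (Hc : forall i, (i < m)%nat -> x i ^ 2 <= nsq m x).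
  { intros i Hi; unfold nsq; apply (rsum_term_le m (fun l => x l ^ 2)); auto.
    intros; apply pow2_ge_0. }
  (* [s] is a sign, so one computation bounds the form from above and from below. *)
  assert (Habs : forall s, s * s = 1 -> s * dotp m x (mv m A x) <= S * nsq m x).
  { intros s Hs; unfold dotp, S; rewrite <- rsum_scal, (Rmult_comm (rsum m _)).
    rewrite <- rsum_scal; apply rsum_le; intros i Hi; unfold mv.
    rewrite <- Rmult_assoc, <- !rsum_scal; apply rsum_le; intros j Hj.
    assert (H1 : s * x i * x j <= nsq m x /\ - (s * x i * x j) <= nsq m x)
      by (pose proof (Hc i Hi); pose proof (Hc j Hj);
          pose proof (pow2_ge_0 (s * x i - x j)); pose proof (pow2_ge_0 (s * x i + x j));
          split; nra).
    pose proof (Rabs_pos (A i j)).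
    unfold Rabs in *; destruct (Rcase_abs (A i j)); nra. }
  pose proof (Habs 1 ltac:(ring)); pose proof (Habs (-1) ltac:(ring)).
  unfold Rabs; destruct (Rcase_abs (dotp m x (mv m A x))); nra.
Qed.

(** With a right inverse [B], the square norm of [x] equals [x.A(Bx)]. Young's inequality for the
    form of [A] bounds it by [C/2 x.Ax + x.Bx / (2C)], and the last term is at most half of the
    square norm when [C] bounds the form of [B]. *)
Lemma psd_coercive_of_solvable m A :
  symmetric m A -> psd m A ->
  (forall b, exists x, forall i, (i < m)%nat -> mv m A x i = b i) ->
  exists c, 0 < c /\ forall x, c * nsq m x <= dotp m x (mv m A x).
Proof.
  intros HA HP H; destruct (right_inverse_of_solvable m A H) as [B HB].
  destruct (quad_form_bound m B) as [C [HC Hb]].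
  exists (/ C); split; [now apply Rinv_0_lt_compat|]; intros x.
  pose proof (psd_young m A x (mv m B x) C HA HP HC) as Hy.
  rewrite (dotp_ext m x x (mv m A (mv m B x)) x) in Hy by auto.
  rewrite (dotp_ext m (mv m B x) (mv m B x) (mv m A (mv m B x)) x) in Hy by auto.
  rewrite <- nsq_dotp, (dotp_sym m (mv m B x) x) in Hy.
  pose proof (Rle_trans _ _ _ (Rle_abs _) (Hb x)) as Hb'.
  assert (H1 : / (2 * C) * dotp m x (mv m B x) <= / 2 * nsq m x).
  { apply Rle_trans with (/ (2 * C) * (C * nsq m x)).
    - apply Rmult_le_compat_l; auto; left; apply Rinv_0_lt_compat; lra.
    - right; field; lra. }
  apply (Rmult_le_reg_l C); auto.
  rewrite <- Rmult_assoc, Rinv_r, Rmult_1_l by lra; lra.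
Qed.

(* At the largest [lam] with [A - lam >= 0], a solvable [A - lam] would be coercive, so that
   [lam] could be increased; hence [A - lam] has a kernel. *)
Lemma rayleigh_min_eigenvalue m A :
  (1 <= m)%nat -> symmetric m A ->
  exists lam, is_eigenvalue m A lam /\
    forall x, lam * nsq m x <= dotp m x (mv m A x).
Proof.
  intros Hm HA.
  set (E := fun mu => forall x, mu * nsq m x <= dotp m x (mv m A x)).
  destruct (quad_form_bound m A) as [C [HC Hb]].
  assert (Hne : exists mu, E mu).
  { exists (- C); intros x; pose proof (Hb x) as H.
    unfold Rabs in H; destruct (Rcase_abs (dotp m x (mv m A x))); [lra|].
    pose proof (nsq_nonneg m x); nra. }
  assert (Hbd : bound E).
  { exists C; intros mu Hmu.
    pose proof (Hmu (basis 0)) as H1; pose proof (Hb (basis 0)) as H2.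
    assert (H3 : 0 < nsq m (basis 0)) by (apply (nsq_pos m _ 0); [lia|unfold basis; simpl; lra]).
    pose proof (Rle_abs (dotp m (basis 0) (mv m A (basis 0)))); nra. }
  destruct (completeness E Hbd Hne) as [lam [Hub Hlub]].
  (* The supremum is attained: for nonzero [x] the condition says that [mu] is at most the Rayleigh
     quotient of [x], which is thus an upper bound of [E]. *)
  assert (Hlam : E lam).
  { intros x; destruct (Rle_lt_or_eq_dec _ _ (nsq_nonneg m x)) as [Hx|Hx].
    - assert (Hq : lam <= dotp m x (mv m A x) / nsq m x).
      { apply Hlub; intros mu Hmu; apply (Rmult_le_reg_r (nsq m x)); auto.
        unfold Rdiv; rewrite Rmult_assoc, Rinv_l, Rmult_1_r by lra; apply Hmu. }
      apply (Rmult_le_compat_r (nsq m x)) in Hq; [|lra].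
      unfold Rdiv in Hq; rewrite Rmult_assoc, Rinv_l, Rmult_1_r in Hq by lra; lra.
    - destruct Hne as [mu Hmu]; specialize (Hmu x); rewrite <- Hx in *; lra. }
  set (A' := fun i j => A i j - (if Nat.eqb i j then lam else 0)).
  assert (HmvA' : forall x i, (i < m)%nat -> mv m A' x i = mv m A x i - lam * x i).
  { intros x i Hi; unfold mv, A'.
    rewrite (rsum_ext m _ (fun j => A i j * x j - lam * (if Nat.eqb i j then x j else 0)))
      by (intros j _; destruct (Nat.eqb i j); ring).
    rewrite rsum_minus, rsum_scal, rsum_delta; auto. }
  assert (HqA' : forall x, dotp m x (mv m A' x) = dotp m x (mv m A x) - lam * nsq m x).
  { intros x; rewrite (dotp_ext m x x _ (fun i => mv m A x i + (- lam) * x i));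
      [| auto | intros; rewrite HmvA'; auto; ring].
    rewrite dotp_plus_r, dotp_scal_r, nsq_dotp; ring. }
  assert (HsA' : symmetric m A').
  { intros i j Hi Hj; unfold A'; rewrite (HA i j), Nat.eqb_sym; auto. }
  assert (HpA' : psd m A') by (intros x; rewrite HqA'; specialize (Hlam x); lra).
  exists lam; split; auto.
  destruct (psd_kernel_or_solvable m A' HsA' HpA') as [[x [Hx Hk]]|Hs].
  - destruct (nsq_pos_inv m x Hx) as [i0 Hi0]; exists x; split; [now exists i0|].
    intros i Hi; specialize (Hk i Hi); rewrite HmvA' in Hk by auto.
    unfold mv in Hk; lra.
  - destruct (psd_coercive_of_solvable m A' HsA' HpA' Hs) as [c [Hc Hcx]].
    assert (lam + c <= lam); [|lra].
    apply Hub; intros x; specialize (Hcx x); rewrite HqA' in Hcx; lra.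
Qed.

(** * The graph Laplacian *)

Section Laplacian.

Variables (n : nat) (a : nat -> nat -> R).
Hypothesis a_nonneg : forall i j, (i < n)%nat -> (j < n)%nat -> a i j >= 0.
Hypothesis a_sym : forall i j, (i < n)%nat -> (j < n)%nat -> a i j = a j i.
Hypothesis a_connected : connected n a.
Variables rho rho2 : R.
Hypothesis rho_largest : is_largest_eig n (laplacian n a) rho.
Hypothesis rho2_smallest : is_smallest_pos_eig n (laplacian n a) rho2.

Notation L := (laplacian n a).

Lemma laplacian_symmetric : symmetric n L.
Proof.
  intros i j Hi Hj; unfold laplacian; rewrite (a_sym i j), Nat.eqb_sym by auto.
  destruct (Nat.eqb_spec j i) as [->|]; reflexivity.
Qed.

Lemma mv_laplacian x i :
  (i < n)%nat -> mv n L x i = rsum n (fun j => a i j * (x i - x j)).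
Proof.
  intros Hi; unfold mv, laplacian.
  rewrite (rsum_ext n _ (fun j =>
    rsum n (fun m => a i m) * (if Nat.eqb i j then x j else 0) - a i j * x j))
    by (intros j _; destruct (Nat.eqb i j); ring).
  rewrite rsum_minus, rsum_scal, rsum_delta by auto.
  rewrite (rsum_ext n (fun j => a i j * (x i - x j))
             (fun j => x i * a i j - a i j * x j)) by (intros; ring).
  rewrite rsum_minus, rsum_scal; change (fun m => a i m) with (a i); ring.
Qed.

(** Exchanging [i] and [j] gives a second expression of the same form, with [- x j] in place of
    [x i]; their sum is the sum over edges. *)
Lemma laplacian_form x :
  2 * dotp n x (mv n L x) = rsum n (fun i => rsum n (fun j => a i j * (x i - x j) ^ 2)).
Proof.
  assert (H1 : dotp n x (mv n L x)
    = rsum n (fun i => rsum n (fun j => a i j * (x i - x j) * x i))).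
  { unfold dotp; apply rsum_ext; intros i Hi; rewrite mv_laplacian by auto.
    rewrite <- rsum_scal; apply rsum_ext; intros; ring. }
  assert (H2 : dotp n x (mv n L x)
    = rsum n (fun i => rsum n (fun j => a i j * (x i - x j) * - x j))).
  { rewrite H1, rsum_swap; apply rsum_ext; intros i Hi; apply rsum_ext; intros j Hj.
    rewrite (a_sym i j) by auto; ring. }
  replace (2 * dotp n x (mv n L x)) with (dotp n x (mv n L x) + dotp n x (mv n L x)) by ring.
  rewrite H1 at 1; rewrite H2, <- rsum_plus; apply rsum_ext; intros i _.
  rewrite <- rsum_plus; apply rsum_ext; intros; ring.
Qed.

Lemma laplacian_psd : psd n L.
Proof.
  intros x; assert (0 <= 2 * dotp n x (mv n L x)); [|lra].
  rewrite laplacian_form; apply rsum_nonneg; intros i Hi; apply rsum_nonneg; intros j Hj.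
  apply Rmult_le_pos; [apply Rge_le; auto|apply pow2_ge_0].
Qed.

Lemma laplacian_const c i : (i < n)%nat -> mv n L (fun _ => c) i = 0.
Proof. intros Hi; rewrite mv_laplacian by auto; apply rsum_zero; intros; ring. Qed.

Lemma rsum_mv_laplacian x : rsum n (mv n L x) = 0.
Proof.
  replace (rsum n (mv n L x)) with (dotp n (fun _ => 1) (mv n L x))
    by (unfold dotp; apply rsum_ext; intros; ring).
  rewrite mv_symm by apply laplacian_symmetric.
  unfold dotp; apply rsum_zero; intros i Hi; rewrite laplacian_const by auto; ring.
Qed.

(** A sum of nonnegative edge terms vanishes only if each does, so [x] agrees at the ends of every
    edge; connectedness carries this along paths. *)
Lemma laplacian_kernel_const x :
  dotp n x (mv n L x) = 0 -> forall i j, (i < n)%nat -> (j < n)%nat -> x i = x j.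
Proof.
  intros H0; assert (Hadj : forall i j, (i < n)%nat -> (j < n)%nat -> a i j > 0 -> x i = x j).
  { intros i j Hi Hj Ha; pose proof (laplacian_form x) as HF; rewrite H0 in HF.
    assert (Hpos : forall i j, (i < n)%nat -> (j < n)%nat -> 0 <= a i j * (x i - x j) ^ 2).
    { intros; apply Rmult_le_pos; [apply Rge_le; auto|apply pow2_ge_0]. }
    pose proof (rsum_term_le n (fun j => a i j * (x i - x j) ^ 2) j
      ltac:(intros; apply Hpos; auto) Hj) as H1.
    pose proof (rsum_term_le n (fun i => rsum n (fun j => a i j * (x i - x j) ^ 2)) i
      ltac:(intros; apply rsum_nonneg; intros; apply Hpos; auto) Hi) as H2.
    cbn beta in *.
    assert (H3 : (x i - x j) ^ 2 <= 0).
    { apply (Rmult_le_reg_l (a i j)); auto; lra. }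
    nra. }
  intros i j Hi Hj; pose proof (a_connected i j Hi Hj) as Hr.
  revert Hi Hj; induction Hr as [i|i j k Hj' Ha Hr IH]; intros Hi Hk; auto.
  rewrite (Hadj i j); auto.
Qed.

Lemma laplacian_dim : (1 <= n)%nat.
Proof. destruct rho_largest as [[v [[i [Hi _]] _]] _]; lia. Qed.

(** This is the least-eigenvalue statement applied to the negated Laplacian. *)
Lemma laplacian_le_rho x : dotp n x (mv n L x) <= rho * nsq n x.
Proof.
  destruct (rayleigh_min_eigenvalue n (fun i j => - L i j) laplacian_dim)
    as [lam [[v [Hv Hev]] Hlam]].
  { intros i j Hi Hj; now rewrite laplacian_symmetric. }
  assert (Hle : - lam <= rho).
  { apply (proj2 rho_largest); exists v; split; auto; intros i Hi.
    specialize (Hev i Hi); cbn beta in Hev.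
    rewrite (rsum_ext n _ (fun j => -1 * (L i j * v j))) in Hev by (intros; ring).
    rewrite rsum_scal in Hev; lra. }
  specialize (Hlam x).
  rewrite (dotp_ext n x x _ (fun i => -1 * mv n L x i)) in Hlam; auto.
  2:{ intros i _; unfold mv; rewrite <- rsum_scal; apply rsum_ext; intros; ring. }
  rewrite dotp_scal_r in Hlam; pose proof (nsq_nonneg n x); nra.
Qed.

(* The rank-one term moves the constant vectors from the kernel of [L] to the eigenvalue
   [rho2]. *)
Definition shifted_laplacian (i j : nat) : R := L i j + rho2 / INR n.

Lemma mv_shifted_laplacian x i :
  mv n shifted_laplacian x i = mv n L x i + rho2 / INR n * rsum n x.
Proof.
  unfold mv, shifted_laplacian; rewrite <- rsum_scal, <- rsum_plus.
  apply rsum_ext; intros; ring.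
Qed.

Lemma shifted_laplacian_symmetric : symmetric n shifted_laplacian.
Proof.
  intros i j Hi Hj; unfold shifted_laplacian; now rewrite laplacian_symmetric.
Qed.

Lemma INR_dim_pos : 0 < INR n.
Proof. apply lt_0_INR; pose proof laplacian_dim; lia. Qed.

Lemma rsum_mv_shifted_laplacian x :
  rsum n (mv n shifted_laplacian x) = rho2 * rsum n x.
Proof.
  rewrite (rsum_ext n _ (fun i => mv n L x i + rho2 / INR n * rsum n x))
    by (intros; apply mv_shifted_laplacian).
  rewrite rsum_plus, rsum_mv_laplacian, rsum_const; field.
  apply Rgt_not_eq, INR_dim_pos.
Qed.

(** Suppose that the least eigenvalue [lam] were below [rho2]. Summing the eigenvector equation
    gives [rho2] and [lam] times the same sum, so the eigenvector has sum zero and is an eigenvector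
    of the Laplacian. A positive [lam] contradicts the minimality of [rho2]; a zero [lam] makes the
    vector constant, hence null. *)
Lemma shifted_laplacian_coercive x :
  rho2 * nsq n x <= dotp n x (mv n shifted_laplacian x).
Proof.
  destruct (rayleigh_min_eigenvalue n shifted_laplacian laplacian_dim
              shifted_laplacian_symmetric) as [lam [[v [[i0 [Hi0 Hv0]] Hev]] Hlam]].
  destruct rho2_smallest as [Hpos [_ Hsm]].
  destruct (Rle_lt_dec rho2 lam) as [Hle|Hlt].
  { pose proof (Hlam x); pose proof (nsq_nonneg n x); nra. }
  exfalso.
  assert (Hev' : forall i, (i < n)%nat -> mv n shifted_laplacian v i = lam * v i) by auto.
  assert (Hs : rsum n v = 0).
  { pose proof (rsum_mv_shifted_laplacian v) as H.
    rewrite (rsum_ext n _ (fun i => lam * v i)), rsum_scal in H by auto.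
    assert (H' : (rho2 - lam) * rsum n v = 0) by lra.
    apply Rmult_integral in H'; lra. }
  assert (HL : forall i, (i < n)%nat -> mv n L v i = lam * v i).
  { intros i Hi; rewrite <- Hev', mv_shifted_laplacian, Hs by auto; ring. }
  assert (Hq : dotp n v (mv n L v) = lam * nsq n v).
  { rewrite (dotp_ext n v v _ (fun i => lam * v i)), dotp_scal_r, nsq_dotp; auto. }
  pose proof (nsq_pos n v i0 Hi0 Hv0) as Hnv.
  pose proof (laplacian_psd v) as Hps; rewrite Hq in Hps.
  assert (Hl0 : 0 <= lam) by nra.
  destruct (Rle_lt_or_eq_dec _ _ Hl0) as [Hl|Hl].
  - assert (rho2 <= lam); [|lra].
    apply Hsm; auto; exists v; split; [now exists i0|exact HL].
  - rewrite <- Hl, Rmult_0_l in Hq.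
    pose proof (laplacian_kernel_const v Hq) as Hc.
    rewrite (rsum_ext n v (fun _ => v i0)), rsum_const in Hs by (intros; auto).
    apply Rmult_integral in Hs; pose proof INR_dim_pos; lra.
Qed.

Lemma shifted_laplacian_sum_zero x i :
  rsum n x = 0 -> mv n shifted_laplacian x i = mv n L x i.
Proof. intros H; rewrite mv_shifted_laplacian, H; ring. Qed.

Lemma laplacian_ge_rho2 x : rsum n x = 0 -> rho2 * nsq n x <= dotp n x (mv n L x).
Proof.
  intros H; rewrite (dotp_ext n x x _ (mv n shifted_laplacian x)); auto.
  - apply shifted_laplacian_coercive.
  - intros; now rewrite shifted_laplacian_sum_zero.
Qed.

Lemma rho2_le_rho : rho2 <= rho.
Proof. apply (proj2 rho_largest), (proj1 (proj2 rho2_smallest)). Qed.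

Lemma rho2_pos : 0 < rho2.
Proof. apply rho2_smallest. Qed.

(** Young's inequality in the form of [L], between [Lx] and [x] with weight [/ rho]: the term in
    [Lx] is at most half of the left side. This avoids the square root of [L]. *)
Lemma nsq_mv_laplacian x : nsq n (mv n L x) <= rho * dotp n x (mv n L x).
Proof.
  assert (Hr : 0 < rho) by (pose proof rho2_le_rho; pose proof rho2_pos; lra).
  pose proof (psd_young n L (mv n L x) x (/ rho) laplacian_symmetric laplacian_psd
    (Rinv_0_lt_compat _ Hr)) as H.
  pose proof (laplacian_le_rho (mv n L x)) as H2.
  rewrite <- nsq_dotp in H.
  replace (/ (2 * / rho)) with (rho / 2) in H by (field; lra).
  assert (H3 : / rho / 2 * dotp n (mv n L x) (mv n L (mv n L x)) <= / 2 * nsq n (mv n L x)).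
  { apply Rle_trans with (/ rho / 2 * (rho * nsq n (mv n L x))).
    - apply Rmult_le_compat_l; auto.
      apply Rlt_le, Rmult_lt_0_compat; [now apply Rinv_0_lt_compat|lra].
    - right; field; lra. }
  lra.
Qed.

(** [Q] inverts the shifted Laplacian, which agrees with [L] on vectors of sum zero. For the bounds
    write [w = Lz] with [z = Qw], also of sum zero: the lower one is the previous inequality for
    [z], the upper one is Young's inequality together with [rho2 |z|^2 <= z.w]. *)
Lemma laplacian_pseudoinverse :
  exists Q, symmetric n Q /\ psd n Q /\
    (forall y i, rsum n y = 0 -> (i < n)%nat -> mv n Q (mv n L y) i = y i) /\
    (forall w, rsum n w = 0 ->
       / rho * nsq n w <= dotp n w (mv n Q w) <= / rho2 * nsq n w).
Proof.
  pose proof rho2_pos as Hr2; pose proof rho2_le_rho as Hr.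
  assert (HpA : psd n shifted_laplacian).
  { intros x; pose proof (shifted_laplacian_coercive x); pose proof (nsq_nonneg n x); nra. }
  destruct (psd_kernel_or_solvable n shifted_laplacian shifted_laplacian_symmetric HpA)
    as [[x [Hx Hk]]|Hs].
  { exfalso; pose proof (shifted_laplacian_coercive x) as H.
    rewrite (dotp_ext n x x _ (fun _ => 0 * 0)), dotp_scal_r in H;
      [nra | auto | intros; rewrite Hk; auto; ring]. }
  destruct (right_inverse_of_solvable n _ Hs) as [Q HQ].
  assert (Hsym : forall x y, dotp n x (mv n Q y) = dotp n y (mv n Q x)).
  { intros x y; rewrite (dotp_ext n x (mv n shifted_laplacian (mv n Q x)) _ (mv n Q y)) by
      (auto; intros; rewrite HQ; auto).
    rewrite dotp_sym, mv_symm, dotp_sym by apply shifted_laplacian_symmetric.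
    apply dotp_ext; auto. }
  exists Q; split; [|split; [|split]].
  - intros i j Hi Hj; rewrite <- (mv_basis n Q j i), <- (mv_basis n Q i j) by auto.
    rewrite <- (dotp_basis n i (mv n Q (basis j))), <- (dotp_basis n j (mv n Q (basis i)))
      by auto.
    apply Hsym.
  - intros x; rewrite (dotp_ext n x (mv n shifted_laplacian (mv n Q x)) _ (mv n Q x)) by
      (auto; intros; rewrite HQ; auto).
    rewrite dotp_sym; apply HpA.
  - intros y i Hy Hi.
    (* [Q] was built as a right inverse only. That it also inverts on the left follows because the
       shifted Laplacian kills [u] and is coercive. *)
    set (u := fun j => mv n Q (mv n L y) j + -1 * y j).
    assert (Hu : forall j, (j < n)%nat -> mv n shifted_laplacian u j = 0).
    { intros j Hj; unfold u; rewrite mv_plus, mv_scal, HQ by auto.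
      rewrite shifted_laplacian_sum_zero by auto; ring. }
    pose proof (shifted_laplacian_coercive u) as H.
    rewrite (dotp_ext n u u _ (fun _ => 0 * 0)), dotp_scal_r in H;
      [| auto | intros; rewrite Hu; auto; ring].
    pose proof (nsq_nonneg n u) as Hn.
    assert (Hz : u i = 0) by (apply (nsq_eq0 n); auto; nra).
    unfold u in Hz; lra.
  - intros w Hw; set (z := mv n Q w).
    assert (Hz : rsum n z = 0).
    { pose proof (rsum_mv_shifted_laplacian z) as H.
      rewrite (rsum_ext n _ w), Hw in H by (intros; apply HQ; auto).
      symmetry in H; apply Rmult_integral in H; lra. }
    assert (HLz : forall i, (i < n)%nat -> w i = mv n L z i).
    { intros i Hi; rewrite <- shifted_laplacian_sum_zero by auto; symmetry; now apply HQ. }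
    pose proof (nsq_mv_laplacian z) as H1; pose proof (laplacian_ge_rho2 z Hz) as H2.
    rewrite (nsq_ext n (mv n L z) w) in H1 by (intros; rewrite HLz; auto).
    rewrite (dotp_ext n z z (mv n L z) w) in * by (auto; intros; rewrite HLz; auto).
    pose proof (dotp_young n rho2 z w Hr2) as H3.
    rewrite (dotp_sym n w z); split.
    + apply (Rmult_le_reg_l rho); [lra|].
      rewrite <- Rmult_assoc, Rinv_r, Rmult_1_l by lra; lra.
    + replace (/ (2 * rho2)) with (/ rho2 / 2) in H3 by (field; lra); lra.
Qed.

End Laplacian.

(** * One step of the quadratic Lyapunov function *)

(** The weights cancel the indefinite terms of first order in [eta]: [w.Qw/2] cancels the [y.w]
    produced by [|y|^2/2], and [alpha |w|^2/(2 beta)] cancels the [Ly.w] produced by the cross term.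
    The cross term itself supplies the dissipation [- eta beta |w|^2], at the price of
    [eta beta y.Ly], whence [alpha - beta]. *)
Definition lyap (n : nat) (Q : nat -> nat -> R) (alpha beta : R) (y w : nat -> R) : R :=
  / 2 * nsq n y + / 2 * dotp n w (mv n Q w) + alpha / (2 * beta) * nsq n w + dotp n y w.

Lemma lyap_step_expand n L Q alpha beta eta y w e d y' w' :
  0 < beta -> symmetric n Q ->
  (forall i, (i < n)%nat -> mv n Q (mv n L y) i = y i) ->
  (forall i, (i < n)%nat ->
     y' i = y i + - eta * (alpha * mv n L y i + (beta * w i + e i))) ->
  (forall i, (i < n)%nat ->
     w' i = w i + (eta * beta * mv n L y i + / beta * d i)) ->
  lyap n Q alpha beta y' w' =
  lyap n Q alpha beta y w
  - eta * (alpha - beta) * dotp n y (mv n L y) - eta * beta * nsq n w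
  - eta * dotp n y e - eta * dotp n e w
  + / beta * dotp n w (mv n Q d) + alpha / beta ^ 2 * dotp n w d + / beta * dotp n y d
  + eta ^ 2 * (/ 2 * (alpha ^ 2 - alpha * beta) * nsq n (mv n L y)
      + / 2 * beta ^ 2 * nsq n w + / 2 * nsq n e
      + (alpha - beta) * beta * dotp n (mv n L y) w
      + (alpha - beta) * dotp n (mv n L y) e
      + beta * dotp n e w + / 2 * beta ^ 2 * dotp n y (mv n L y))
  + eta * dotp n y d
  + / (2 * beta ^ 2) * (dotp n d (mv n Q d) + alpha / beta * nsq n d)
  - eta * dotp n w d - eta / beta * dotp n e d.
Proof.
  intros Hb HQ HQL Hy' Hw'.
  assert (HQw' : forall i, (i < n)%nat ->
    mv n Q w' i = mv n Q w i + (eta * beta * y i + / beta * mv n Q d i)).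
  { intros i Hi; rewrite (mv_ext n Q w' _ i Hw'), mv_plus, mv_plus, !mv_scal, HQL; auto. }
  assert (Hmw : dotp n (mv n L y) (mv n Q w) = dotp n y w).
  { rewrite mv_symm by auto; rewrite dotp_sym; apply dotp_ext; auto. }
  assert (Hmd : dotp n (mv n L y) (mv n Q d) = dotp n y d).
  { rewrite mv_symm by auto; rewrite dotp_sym; apply dotp_ext; auto. }
  assert (Hdw : dotp n d (mv n Q w) = dotp n w (mv n Q d)) by (apply mv_symm; auto).
  unfold lyap.
  rewrite (dotp_ext n w' _ (mv n Q w') _ Hw' HQw').
  rewrite (dotp_ext n y' _ w' _ Hy' Hw').
  rewrite (nsq_ext n y' _ Hy'), (nsq_ext n w' _ Hw'), !nsq_dotp.
  set (m := mv n L y) in *; set (qw := mv n Q w) in *; set (qd := mv n Q d) in *.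
  clearbody m qw qd.
  rewrite !dotp_plus_l, !dotp_scal_l, !dotp_plus_l, !dotp_scal_l.
  rewrite !dotp_plus_r, !dotp_scal_r, !dotp_plus_r, !dotp_scal_r.
  rewrite Hmw, Hmd, Hdw.
  rewrite (dotp_sym n w y), (dotp_sym n m y), (dotp_sym n w m), (dotp_sym n e y),
    (dotp_sym n e m), (dotp_sym n w e), (dotp_sym n d w), (dotp_sym n d y), (dotp_sym n d m).
  field; lra.
Qed.

Ltac pos :=
  unfold Rdiv;
  repeat (apply Rmult_lt_0_compat || apply Rmult_le_pos || apply Rinv_0_lt_compat
          || apply pow_lt || apply pow_le || apply Rlt_le, Rinv_0_lt_compat);
  lra.

(** Young's inequality in discriminant form, which lets both weights and the coefficient of the
    product be prescribed independently. *)
Lemma dotp_le_quad m s P Q x y :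
  0 < P -> s ^ 2 <= 4 * P * Q -> s * dotp m x y <= P * nsq m x + Q * nsq m y.
Proof.
  intros HP Hs; unfold dotp, nsq; rewrite <- !rsum_scal, <- rsum_plus.
  apply rsum_le; intros i _; apply (Rmult_le_reg_l (4 * P)); [lra|].
  pose proof (pow2_ge_0 (2 * P * x i - s * y i)); pose proof (pow2_ge_0 (y i)); nra.
Qed.

Lemma psd_le_quad m A s P Q x y :
  symmetric m A -> psd m A -> 0 < P -> s ^ 2 <= 4 * P * Q ->
  s * dotp m x (mv m A y) <= P * dotp m x (mv m A x) + Q * dotp m y (mv m A y).
Proof.
  intros HA HA' HP Hs; apply (Rmult_le_reg_l (4 * P)); [lra|].
  pose proof (psd_quad m A x y (- s / (2 * P)) HA HA') as H.
  apply (Rmult_le_compat_l (4 * P ^ 2)) in H; [|nra].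
  replace (4 * P ^ 2 * (dotp m x (mv m A x) + 2 * (- s / (2 * P)) * dotp m x (mv m A y)
     + (- s / (2 * P)) ^ 2 * dotp m y (mv m A y))) with
    (4 * P ^ 2 * dotp m x (mv m A x) - 4 * P * s * dotp m x (mv m A y)
     + s ^ 2 * dotp m y (mv m A y)) in H by (field; lra).
  pose proof (HA' y); nra.
Qed.

(** Each product in the exact expansion is split so that [y] and [w] receive only what the
    dissipation can pay for; the rest is charged to [e] and [d]. *)
Lemma lyap_step n L Q alpha beta eta rho rho2 y w e d y' w' :
  0 < eta -> 0 < beta -> beta < alpha -> 0 < rho2 -> 1 <= alpha * rho ->
  symmetric n Q -> psd n Q ->
  (forall i, (i < n)%nat -> mv n Q (mv n L y) i = y i) ->
  dotp n w (mv n Q w) <= / rho2 * nsq n w ->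
  dotp n d (mv n Q d) <= / rho2 * nsq n d ->
  rho2 * nsq n y <= dotp n y (mv n L y) ->
  dotp n y (mv n L y) <= rho * nsq n y ->
  nsq n (mv n L y) <= rho * dotp n y (mv n L y) ->
  (forall i, (i < n)%nat ->
     y' i = y i + - eta * (alpha * mv n L y i + (beta * w i + e i))) ->
  (forall i, (i < n)%nat ->
     w' i = w i + (eta * beta * mv n L y i + / beta * d i)) ->
  lyap n Q alpha beta y' w' <=
  lyap n Q alpha beta y w
  - eta * ((alpha - beta) * rho2 - 1 - eta * (/ 2 * beta ^ 2 * rho + 2 * alpha ^ 2 * rho ^ 2))
      * nsq n y
  - eta * (beta - / 2 - / (2 * beta) * (/ rho2 + alpha / beta) - eta * (2 * beta ^ 2)) * nsq n w
  + (eta + 7 / 4 * eta ^ 2) * nsq n e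
  + ((/ beta ^ 2 + / (2 * eta * beta)) * (/ rho2 + alpha / beta)
      + / (2 * eta * beta ^ 2) + / beta ^ 2 + / 2) * nsq n d.
Proof.
  intros He Hb Hab Hr2 Har HQ HPQ HQL HwQ HdQ Hlo Hup HLL Hy' Hw'.
  rewrite (lyap_step_expand n L Q alpha beta eta y w e d y' w') by auto.
  assert (Hrho : 0 < rho) by nra.
  set (yy := nsq n y) in *; set (ww := nsq n w) in *; set (ee := nsq n e) in *;
    set (dd := nsq n d) in *.
  assert (Hyy : 0 <= yy) by apply nsq_nonneg; assert (Hww : 0 <= ww) by apply nsq_nonneg.
  assert (Hee : 0 <= ee) by apply nsq_nonneg; assert (Hdd : 0 <= dd) by apply nsq_nonneg.
  assert (Heb : 0 < eta * beta) by (apply Rmult_lt_0_compat; auto).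
  assert (Hib : 0 < / beta) by now apply Rinv_0_lt_compat.
  assert (Hie : 0 < / eta) by now apply Rinv_0_lt_compat.
  assert (Hir : 0 < / rho2) by now apply Rinv_0_lt_compat.
  assert (Hib2 : 0 < / beta ^ 2) by pos.
  assert (Hieb : 0 < / (eta * beta)) by now apply Rinv_0_lt_compat.
  pose proof (dotp_le_quad n (- eta) (eta / 2) (eta / 2) y e ltac:(lra) ltac:(lra)) as Y1.
  pose proof (dotp_le_quad n (- eta) (eta / 2) (eta / 2) e w ltac:(lra) ltac:(lra)) as Y2.
  (* The products with [d] that carry no factor [eta] must be balanced against [eta] times squares
     of [w] and [y]; this is the origin of the coefficients with [/ eta] in front of [nsq n d]. *)
  pose proof (psd_le_quad n Q (/ beta) (eta / 2 * / beta) (/ 2 * / (eta * beta)) w d HQ HPQ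
    ltac:(pos) ltac:(right; field; lra)) as Y3.
  pose proof (dotp_le_quad n (alpha / beta ^ 2) (eta / 2 * (alpha * / beta ^ 2))
    (/ 2 * / eta * alpha * / beta ^ 2) w d
    ltac:(pos) ltac:(right; field; lra)) as Y4.
  pose proof (dotp_le_quad n (/ beta) (eta / 2) (/ 2 * / eta * / beta ^ 2) y d
    ltac:(lra) ltac:(right; field; lra)) as Y5.
  pose proof (dotp_le_quad n eta (eta ^ 2 / 2) (/ 2) y d ltac:(pos) ltac:(lra)) as Y6.
  pose proof (dotp_le_quad n (- eta) (eta ^ 2 * beta ^ 2 / 2) (/ 2 * / beta ^ 2) w d
    ltac:(pos) ltac:(right; field; lra)) as Y7.
  pose proof (dotp_le_quad n (- (eta / beta)) (eta ^ 2 / 4) (/ beta ^ 2) e d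
    ltac:(pos) ltac:(right; field; lra)) as Y8.
  assert (He2 : 0 < eta ^ 2) by pos.
  assert (Hab2 : 0 < (alpha - beta) ^ 2) by pos.
  pose proof (dotp_le_quad n (eta ^ 2 * ((alpha - beta) * beta))
    (eta ^ 2 * / 2 * (alpha - beta) ^ 2) (eta ^ 2 * / 2 * beta ^ 2) (mv n L y) w
    ltac:(pos) ltac:(right; field)) as Y9.
  pose proof (dotp_le_quad n (eta ^ 2 * (alpha - beta))
    (eta ^ 2 * / 2 * (alpha - beta) ^ 2) (eta ^ 2 * / 2) (mv n L y) e
    ltac:(pos) ltac:(right; field)) as Y10.
  pose proof (dotp_le_quad n (eta ^ 2 * beta) (eta ^ 2 * / 2) (eta ^ 2 * / 2 * beta ^ 2) e w
    ltac:(pos) ltac:(right; field)) as Y11.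
  fold yy ww ee dd in Y1, Y2, Y3, Y4, Y5, Y6, Y7, Y8, Y9, Y10, Y11.
  set (mm := nsq n (mv n L y)) in *; set (ym := dotp n y (mv n L y)) in *.
  set (wQw := dotp n w (mv n Q w)) in *; set (dQd := dotp n d (mv n Q d)) in *.
  assert (Z1 : eta * (alpha - beta) * (rho2 * yy) <= eta * (alpha - beta) * ym)
    by (apply Rmult_le_compat_l; [pos|lra]).
  assert (Z2 : eta ^ 2 * (/ 2 * beta ^ 2) * ym <= eta ^ 2 * (/ 2 * beta ^ 2) * (rho * yy))
    by (apply Rmult_le_compat_l; [pos|lra]).
  assert (Hmm : 0 <= mm) by apply nsq_nonneg.
  assert (Hmm2 : mm <= rho ^ 2 * yy) by (clear - HLL Hup Hrho; nra).
  assert (Z3 : eta ^ 2 * (/ 2 * (alpha ^ 2 - alpha * beta) + (alpha - beta) ^ 2) * mm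
    <= eta ^ 2 * (3 / 2 * alpha ^ 2) * (rho ^ 2 * yy)).
  { apply Rle_trans with (eta ^ 2 * (3 / 2 * alpha ^ 2) * mm).
    - apply Rmult_le_compat_r; auto; apply Rmult_le_compat_l; [pos|]; clear - Hb Hab; nra.
    - apply Rmult_le_compat_l; auto; pos. }
  (* The stray [eta ^ 2 / 2] left by [Y6] is absorbed thanks to [1 <= alpha * rho], completing [3/2]
     to the coefficient 2. *)
  assert (Z4 : eta ^ 2 / 2 * yy <= eta ^ 2 * (/ 2 * alpha ^ 2) * (rho ^ 2 * yy)).
  { replace (eta ^ 2 * (/ 2 * alpha ^ 2) * (rho ^ 2 * yy)) with
      (eta ^ 2 / 2 * yy * (alpha * rho) ^ 2) by field.
    assert (H0 : 0 <= eta ^ 2 / 2 * yy) by pos.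
    assert (H1 : 1 <= (alpha * rho) ^ 2) by nra; clear - H0 H1; nra. }
  assert (Z5 : eta / 2 * / beta * wQw <= eta / 2 * / beta * (/ rho2 * ww))
    by (apply Rmult_le_compat_l; [pos|lra]).
  assert (Z6 : / 2 * / (eta * beta) * dQd <= / 2 * / (eta * beta) * (/ rho2 * dd))
    by (apply Rmult_le_compat_l; [pos|lra]).
  assert (Z7 : / 2 * / beta ^ 2 * dQd <= / 2 * / beta ^ 2 * (/ rho2 * dd))
    by (apply Rmult_le_compat_l; [pos|lra]).
  (* The remainder of [Y7] is merged with the exact quadratic term in [d], which doubles the
     latter's coefficient to [/ beta ^ 2]. *)
  assert (Z8 : / 2 * / beta ^ 2 * dd <= / 2 * / beta ^ 2 * (/ rho2 + alpha / beta) * dd).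
  { assert (H1 : 1 <= alpha / beta).
    { apply (Rmult_le_reg_r beta); auto; unfold Rdiv.
      rewrite Rmult_assoc, Rinv_l by lra; lra. }
    assert (H0 : 0 <= / 2 * / beta ^ 2 * dd) by pos; clear - H0 H1 Hir; nra. }
  unfold Rdiv in *; rewrite ?Rinv_mult, <- ?pow_inv in *.
  lra.
Qed.

(** * Smooth functions *)

Lemma nsq_scal m c x : nsq m (fun l => c * x l) = c ^ 2 * nsq m x.
Proof. unfold nsq; rewrite <- rsum_scal; apply rsum_ext; intros; ring. Qed.

Lemma nsq_plus m x y : nsq m (fun l => x l + y l) = nsq m x + 2 * dotp m x y + nsq m y.
Proof.
  rewrite !nsq_dotp, dotp_plus_l, !dotp_plus_r, (dotp_sym m y x); ring.
Qed.

Lemma nsq_vsub_sym m x y : nsq m (vsub x y) = nsq m (vsub y x).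
Proof. unfold nsq, vsub; apply rsum_ext; intros; ring. Qed.

Lemma nsq_plus_le m x y c d :
  0 <= c -> 0 <= d -> nsq m x <= c ^ 2 -> nsq m y <= d ^ 2 ->
  nsq m (fun l => x l + y l) <= (c + d) ^ 2.
Proof.
  intros Hc Hd Hx Hy; rewrite nsq_plus.
  assert (dotp m x y <= c * d); [|nra].
  pose proof (nsq_nonneg m x); pose proof (nsq_nonneg m y).
  (* The weights below are [d ^ 2 / 2] and [c ^ 2 / 2]; when a bound is zero, the vector vanishes
     and so does the product. *)
  destruct (Req_dec c 0) as [->|Hc0].
  { right; unfold dotp; rewrite rsum_zero; [ring|]; intros i Hi.
    rewrite (nsq_eq0 m x i) by (auto; lra); ring. }
  destruct (Req_dec d 0) as [->|Hd0].
  { right; unfold dotp; rewrite rsum_zero; [ring|]; intros i Hi.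
    rewrite (nsq_eq0 m y i) by (auto; lra); ring. }
  pose proof (dotp_le_quad m (c * d) (d ^ 2 / 2) (c ^ 2 / 2) x y ltac:(pos) ltac:(nra)) as H1.
  assert (0 < c * d) by pos; apply (Rmult_le_reg_l (c * d)); auto; nra.
Qed.

Section Smooth.

Variables (p : nat) (h : vec -> R) (gr : vec -> vec) (K : R).
Hypothesis h_dep : dep_p p h.
Hypothesis h_grad : is_gradient p h gr.
Hypothesis K_pos : K > 0.
Hypothesis gr_lip : forall y z,
  sqrt (nsq p (vsub (gr y) (gr z))) <= K * sqrt (nsq p (vsub y z)).

Lemma nsq_gradient_lipschitz y z :
  nsq p (vsub (gr y) (gr z)) <= K ^ 2 * nsq p (vsub y z).
Proof.
  pose proof (gr_lip y z) as H.
  pose proof (sqrt_pos (nsq p (vsub (gr y) (gr z)))).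
  pose proof (sqrt_pos (nsq p (vsub y z))).
  rewrite <- (pow2_sqrt (nsq p (vsub (gr y) (gr z)))) by apply nsq_nonneg.
  rewrite <- (pow2_sqrt (nsq p (vsub y z))) by apply nsq_nonneg.
  nra.
Qed.

Lemma derivable_along_line x z s :
  derivable_pt_lim (fun t => h (fun l => x l + t * z l)) s
    (dotp p (gr (fun l => x l + s * z l)) z).
Proof.
  intros eps Heps; set (N := sqrt (nsq p z)).
  assert (HN : 0 <= N) by apply sqrt_pos.
  (* [1 + N] rather than [N] keeps the tolerance defined when [z] vanishes. *)
  destruct (h_grad (fun l => x l + s * z l) (eps / (2 * (1 + N)))) as [d [Hd Hlim]].
  { apply Rlt_gt; pos. }
  assert (Hdel : 0 < d / (1 + N)) by pos.
  exists (mkposreal _ Hdel); intros t Ht Habs; simpl in Habs.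
  assert (Hnorm : sqrt (nsq p (fun l => t * z l)) = Rabs t * N).
  { rewrite nsq_scal, sqrt_mult; [| apply pow2_ge_0 | apply nsq_nonneg].
    rewrite <- pow2_abs, sqrt_pow2 by apply Rabs_pos; reflexivity. }
  assert (Ht' : 0 < Rabs t) by now apply Rabs_pos_lt.
  pose proof (Hlim (fun l => t * z l)) as H; rewrite Hnorm in H.
  rewrite dotp_scal_r in H.
  rewrite (h_dep (fun l => x l + (s + t) * z l)
    (fun l => x l + s * z l + t * z l)) by (intros; ring).
  set (A := h (fun l => x l + s * z l + t * z l)) in *.
  set (B := h (fun l => x l + s * z l)) in *.
  set (D := dotp p (gr (fun l => x l + s * z l)) z) in *.
  replace ((A - B) / t - D) with ((A - B - t * D) / t) by (field; auto).
  unfold Rdiv; rewrite Rabs_mult, Rabs_inv.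
  apply (Rmult_lt_reg_r (Rabs t)); auto.
  rewrite Rmult_assoc, Rinv_l, Rmult_1_r by lra.
  assert (Hlt : Rabs t * (1 + N) < d).
  { apply (Rmult_lt_compat_r (1 + N)) in Habs; [|lra].
    unfold Rdiv in Habs; rewrite Rmult_assoc, Rinv_l in Habs by lra; lra. }
  eapply Rle_lt_trans; [apply H; nra|].
  assert (E : eps / (2 * (1 + N)) * (Rabs t * N) = eps * Rabs t * (N / (2 * (1 + N))))
    by (field; lra).
  rewrite E; assert (N / (2 * (1 + N)) < 1).
  { apply (Rmult_lt_reg_r (2 * (1 + N))); [lra|].
    unfold Rdiv; rewrite Rmult_assoc, Rinv_l by lra; lra. }
  assert (0 < eps * Rabs t) by pos; nra.
Qed.

(** The mean value theorem is applied along the segment to the signed linearization error minus its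
    quadratic bound, whose derivative is nonpositive by the Lipschitz condition. The two signs [s]
    give the absolute value. *)
Lemma smooth_bound x z :
  Rabs (h (fun l => x l + z l) - h x - dotp p (gr x) z) <= K / 2 * nsq p z.
Proof.
  assert (Hs : forall s, s * s = 1 ->
    s * (h (fun l => x l + z l) - h x - dotp p (gr x) z) <= K / 2 * nsq p z).
  { intros s Hs.
    set (D := dotp p (gr x) z).
    set (psi := fun t => s * (h (fun l => x l + t * z l) - D * t) - K / 2 * nsq p z * t ^ 2).
    set (psi' := fun t => s * (dotp p (gr (fun l => x l + t * z l)) z - D)
                          - K * nsq p z * t).
    destruct (MVT_cor2 psi psi' 0 1) as [c [Hc Hc01]]; [lra| |].
    { intros t _; unfold psi, psi'.
      replace (K * nsq p z * t) with (K / 2 * nsq p z * (INR 2 * t ^ pred 2)) by (simpl; field).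
      apply (derivable_pt_lim_minus
        (fun t => s * (h (fun l => x l + t * z l) - D * t))
        (fun t => K / 2 * nsq p z * t ^ 2)).
      - apply (derivable_pt_lim_scal (fun t => h (fun l => x l + t * z l) - D * t)).
        apply (derivable_pt_lim_minus (fun t => h (fun l => x l + t * z l)) (fun t => D * t)).
        + apply derivable_along_line.
        + pose proof (derivable_pt_lim_scal id D t 1 (derivable_pt_lim_id t)) as H.
          rewrite Rmult_1_r in H; exact H.
      - apply (derivable_pt_lim_scal (fun t => t ^ 2)).
        apply derivable_pt_lim_pow. }
    set (xc := fun l => x l + c * z l).
    assert (Hder : psi' c <= 0).
    { unfold psi'; fold xc; unfold D.
      (* The gradients differ by at most [K c] times the norm of [z], so these weights make both
         halves equal to [K c / 2] times its square; [c] is positive because the mean value point is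
         interior. *)
      pose proof (dotp_le_quad p s (/ (2 * K * c)) (K * c / 2) (vsub (gr xc) (gr x)) z
        ltac:(pos)) as H.
      assert (Hq : s ^ 2 <= 4 * / (2 * K * c) * (K * c / 2)).
      { right; rewrite <- Rsqr_pow2; unfold Rsqr; rewrite Hs; field; lra. }
      specialize (H Hq).
      assert (El : dotp p (vsub (gr xc) (gr x)) z = dotp p (gr xc) z - dotp p (gr x) z).
      { unfold dotp, vsub; rewrite <- rsum_minus; apply rsum_ext; intros; ring. }
      rewrite El in H.
      pose proof (nsq_gradient_lipschitz xc x) as HL.
      rewrite (nsq_ext p (vsub xc x) (fun l => c * z l)), nsq_scal in HL
        by (intros; unfold vsub, xc; ring).
      assert (/ (2 * K * c) * nsq p (vsub (gr xc) (gr x)) <= K * c / 2 * nsq p z).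
      { apply Rle_trans with (/ (2 * K * c) * (K ^ 2 * (c ^ 2 * nsq p z))).
        - apply Rmult_le_compat_l; auto; pos.
        - right; field; lra. }
      lra. }
    unfold psi in Hc.
    rewrite (h_dep (fun l => x l + 1 * z l) (fun l => x l + z l)) in Hc by (intros; ring).
    rewrite (h_dep (fun l => x l + 0 * z l) x) in Hc by (intros; ring).
    lra. }
  pose proof (Hs 1 ltac:(ring)); pose proof (Hs (-1) ltac:(ring)).
  unfold Rabs; destruct (Rcase_abs _); lra.
Qed.

(** Along [d] times a basis vector the smoothness bound says that a forward difference errs by at
    most [K d / 2]; this is squared and summed over the coordinates. *)
Lemma hatgrad_error x d :
  0 < d -> nsq p (vsub (hatgrad p h x d) (gr x)) <= INR p * (K ^ 2 * d ^ 2 / 4).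
Proof.
  intros Hd; rewrite <- rsum_const; unfold nsq; apply rsum_le; intros l Hl.
  unfold vsub, hatgrad; rewrite (proj2 (Nat.ltb_lt l p) Hl).
  pose proof (smooth_bound x (fun m => d * basis l m)) as H.
  rewrite dotp_scal_r, nsq_scal, nsq_dotp, dotp_sym, !dotp_basis in H by auto.
  replace (basis l l) with 1 in H by (unfold basis; now rewrite Nat.eqb_refl).
  rewrite (h_dep (shift x d l) (fun m => x m + d * basis l m)).
  2:{ intros m _; unfold shift, basis; rewrite Nat.eqb_sym.
      destruct (Nat.eqb l m); ring. }
  set (A := h (fun m => x m + d * basis l m)) in *.
  replace ((A - h x) / d - gr x l) with ((A - h x - d * gr x l) / d) by (field; lra).
  unfold Rdiv; rewrite Rpow_mult_distr, pow_inv.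
  apply (Rmult_le_reg_r (d ^ 2)); [pos|].
  rewrite Rmult_assoc, Rinv_l, Rmult_1_r by nra.
  rewrite <- pow2_abs.
  pose proof (Rabs_pos (A - h x - d * gr x l)).
  replace (K ^ 2 * d ^ 2 * / 4 * d ^ 2) with ((K / 2 * (d ^ 2 * 1)) ^ 2) by field.
  apply pow_incr; split; auto.
Qed.

End Smooth.

(** * Quadratic growth from the Polyak-Lojasiewicz inequality *)

Lemma Un_cv_rsum m (u : nat -> nat -> R) (ul : nat -> R) :
  (forall l, (l < m)%nat -> Un_cv (fun k => u k l) (ul l)) ->
  Un_cv (fun k => rsum m (u k)) (rsum m ul).
Proof.
  induction m as [|m IH]; intros H; simpl.
  - intros eps Heps; exists 0%nat; intros; unfold Rdist; rewrite Rminus_diag, Rabs_R0; lra.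
  - apply (CV_plus (fun k => rsum m (u k)) (fun k => u k m)); auto.
Qed.

Lemma Un_cv_const c : Un_cv (fun _ => c) c.
Proof.
  intros eps Heps; exists 0%nat; intros; unfold Rdist; rewrite Rminus_diag, Rabs_R0; lra.
Qed.

Lemma Un_cv_nsq_vsub m (u : nat -> vec) (ul x : vec) :
  (forall l, (l < m)%nat -> Un_cv (fun k => u k l) (ul l)) ->
  Un_cv (fun k => nsq m (vsub (u k) x)) (nsq m (vsub ul x)).
Proof.
  intros H; apply (Un_cv_rsum m (fun k l => vsub (u k) x l ^ 2)); intros l Hl; unfold vsub.
  assert (H1 : Un_cv (fun k => u k l - x l) (ul l - x l)).
  { apply (CV_minus (fun k => u k l) (fun _ => x l)); auto using Un_cv_const. }
  replace ((ul l - x l) ^ 2) with ((ul l - x l) * (ul l - x l)) by ring.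
  eapply Un_cv_ext; [|apply (CV_mult _ _ _ _ H1 H1)].
  intros k; cbn beta; ring.
Qed.

Section QuadraticGrowth.

Variables (p : nat) (h : vec -> R) (gr : vec -> vec) (K nu fstar : R).
Hypothesis h_dep : dep_p p h.
Hypothesis K_pos : K > 0.
Hypothesis nu_pos : nu > 0.
Hypothesis h_descent : forall x z,
  h (fun l => x l + z l) <= h x + dotp p (gr x) z + K / 2 * nsq p z.
Hypothesis h_ge : forall y, h y >= fstar.
Hypothesis h_pl : forall y, / 2 * nsq p (gr y) >= nu * (h y - fstar).

Lemma descent_step x gam :
  h (fun l => x l + - gam * gr x l) <= h x - gam * (1 - gam * K / 2) * nsq p (gr x).
Proof.
  pose proof (h_descent x (fun l => - gam * gr x l)) as H.
  rewrite dotp_scal_r, nsq_scal, <- nsq_dotp in H; nra.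
Qed.

(** A gradient step of length [/ K] cannot go below [fstar]. *)
Lemma gradient_le_gap x : nsq p (gr x) <= 2 * K * (h x - fstar).
Proof.
  pose proof (descent_step x (/ K)) as H.
  pose proof (h_ge (fun l => x l + - / K * gr x l)).
  replace (/ K * (1 - / K * K / 2)) with (/ (2 * K)) in H by (field; lra).
  apply (Rmult_le_reg_l (/ (2 * K))); [pos|].
  rewrite <- (Rmult_assoc (/ (2 * K))), Rinv_l by lra; lra.
Qed.

Fixpoint gd (gam : R) (x : vec) (j : nat) : vec :=
  match j with
  | O => x
  | S j' => fun l => gd gam x j' l + - gam * gr (gd gam x j') l
  end.

(** This restarts the path estimate at iterate [j], as the Cauchy property demands. *)
Lemma gd_plus gam x j i : gd gam x (j + i) = gd gam (gd gam x j) i.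
Proof.
  induction i as [|i IH]; [now rewrite Nat.add_0_r|].
  rewrite Nat.add_succ_r; simpl; now rewrite IH.
Qed.

(* The gap of [sqrt (h - fstar)] controls the path length, because under the PL inequality
   [sqrt (h - fstar)] decreases along the gradient at a rate bounded below. *)
Lemma gd_path_length gam s x i :
  0 < gam -> s = 1 - gam * K / 2 -> 0 < s ->
  sqrt (h (gd gam x i) - fstar) <= sqrt (h x - fstar) /\
  nsq p (vsub (gd gam x i) x) <=
    ((sqrt (h x - fstar) - sqrt (h (gd gam x i) - fstar)) / (s * sqrt (nu / 2))) ^ 2.
Proof.
  intros Hgam Es Hs; set (m := sqrt (nu / 2)).
  assert (Hm : 0 < m) by (apply sqrt_lt_R0; lra).
  assert (Hm2 : m ^ 2 = nu / 2) by (apply pow2_sqrt; lra).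
  assert (Hsm : 0 < / (s * m)) by pos.
  induction i as [|i [IH1 IH2]].
  { simpl gd; split; [lra|].
    replace (nsq p (vsub x x)) with 0; [apply pow2_ge_0|].
    symmetry; unfold nsq, vsub; apply rsum_zero; intros; ring. }
  set (y := gd gam x i) in *.
  assert (Hy : gd gam x (S i) = (fun l => y l + - gam * gr y l)) by reflexivity.
  rewrite Hy; set (y' := fun l => y l + - gam * gr y l).
  pose proof (descent_step y gam) as Hd; rewrite <- Es in Hd; fold y' in Hd.
  pose proof (h_ge y); pose proof (h_ge y'); pose proof (h_pl y) as Hpl.
  pose proof (gradient_le_gap y) as Hgap.
  set (A := sqrt (h y - fstar)) in *; set (B := sqrt (h y' - fstar)) in *.
  set (A0 := sqrt (h x - fstar)) in *.
  assert (HA : 0 <= A) by apply sqrt_pos; assert (HB : 0 <= B) by apply sqrt_pos.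
  assert (HA2 : A ^ 2 = h y - fstar) by (apply pow2_sqrt; lra).
  assert (HB2 : B ^ 2 = h y' - fstar) by (apply pow2_sqrt; lra).
  set (G := sqrt (nsq p (gr y))).
  assert (HG : 0 <= G) by apply sqrt_pos.
  assert (HG2 : G ^ 2 = nsq p (gr y)) by (apply pow2_sqrt, nsq_nonneg).
  rewrite <- HG2 in *; rewrite <- HA2 in *.
  assert (Hgs : 0 < gam * s) by pos.
  assert (HAB : gam * s * G ^ 2 <= A ^ 2 - B ^ 2) by lra.
  assert (HBA : B <= A) by nra.
  assert (HGA : 2 * m * A <= G) by nra.
  (* The decrease [gam s G^2] is at most [(A - B)(A + B)], hence at most [2 A (A - B)], while the PL
     inequality gives [2 m A <= G]. If [A] is zero, the upper bound on the gradient gives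
     [G = 0]. *)
  assert (Hstep : gam * G * (s * m) <= A - B).
  { destruct (Rle_lt_or_eq_dec _ _ HA) as [HApos|HA0].
    - apply (Rmult_le_reg_l (2 * A)); [lra|].
      apply Rle_trans with (gam * s * G ^ 2); [|nra].
      replace (2 * A * (gam * G * (s * m))) with (gam * s * G * (2 * m * A)) by ring.
      replace (gam * s * G ^ 2) with (gam * s * G * G) by ring.
      apply Rmult_le_compat_l; auto; pos.
    - rewrite <- HA0 in *; assert (G = 0) by nra; nra. }
  split; [lra|].
  assert (Hst : gam * G <= (A - B) / (s * m)).
  { apply (Rmult_le_reg_r (s * m)); [pos|].
    replace ((A - B) / (s * m) * (s * m)) with (A - B) by (field; lra); lra. }
  rewrite (nsq_ext p (vsub y' x) (fun l => vsub y x l + - gam * gr y l))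
    by (intros; unfold vsub, y'; ring).
  assert (Hq0 : 0 <= (A0 - A) / (s * m)) by (apply Rmult_le_pos; lra).
  assert (Hq1 : 0 <= (A - B) / (s * m)) by (apply Rmult_le_pos; lra).
  replace ((A0 - B) / (s * m)) with ((A0 - A) / (s * m) + (A - B) / (s * m)) by (field; lra).
  apply nsq_plus_le; auto.
  rewrite nsq_scal, <- HG2.
  replace ((- gam) ^ 2 * G ^ 2) with ((gam * G) ^ 2) by ring.
  apply pow_incr; split; auto; pos.
Qed.

(** Every step decreases [h] by a fixed multiple of the current gap, and the gap never grows, so the
    last gap bounds all these decreases from below. A rate of order 1/i suffices for the limit. *)
Lemma gd_gap gam s x i :
  0 < gam -> s = 1 - gam * K / 2 -> 0 < s ->
  INR i * (2 * nu * gam * s) * (h (gd gam x i) - fstar) <= h x - h (gd gam x i).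
Proof.
  intros Hgam Es Hs; induction i as [|i IH].
  { simpl; lra. }
  rewrite S_INR; set (y := gd gam x i) in *.
  change (gd gam x (S i)) with (fun l => y l + - gam * gr y l).
  pose proof (descent_step y gam) as Hd; rewrite <- Es in Hd.
  set (y' := fun l => y l + - gam * gr y l) in *.
  pose proof (h_pl y) as Hpl; pose proof (h_ge y); pose proof (h_ge y').
  assert (Hgs : 0 < gam * s) by pos.
  assert (Hc : gam * s * nsq p (gr y) >= 2 * nu * gam * s * (h y - fstar)).
  { replace (2 * nu * gam * s * (h y - fstar)) with (gam * s * (2 * (nu * (h y - fstar)))) by ring.
    apply Rle_ge, Rmult_le_compat_l; lra. }
  set (c := 2 * nu * gam * s) in *.
  assert (Hc0 : 0 < c) by (unfold c; pos).
  pose proof (pos_INR i).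
  assert (H3 : (INR i + 1) * c * (h y' - fstar) <= (INR i + 1) * c * (h y - fstar)).
  { apply Rmult_le_compat_l; [pos|]; assert (0 <= c * (h y - fstar)) by pos; lra. }
  lra.
Qed.

(** The path estimate, restarted at iterate [j], bounds all later displacements by [D] times the gap
    there. The iterates are thus Cauchy, and the case [j = 0] passes to the limit. *)
Lemma gd_limit gam s x :
  0 < gam -> s = 1 - gam * K / 2 -> 0 < s ->
  exists y, h y = fstar /\ nsq p (vsub x y) <= 2 / nu * (h x - fstar) / s ^ 2.
Proof.
  intros Hgam Es Hs.
  set (c := 2 * nu * gam * s); assert (Hc : 0 < c) by (unfold c; pos).
  set (D := / (nu / 2 * s ^ 2)); assert (HD : 0 < D) by (unfold D; pos).
  set (r := fun j => h (gd gam x j) - fstar).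
  assert (Hr0 : forall j, 0 <= r j) by (intros j; unfold r; pose proof (h_ge (gd gam x j)); lra).
  assert (Hrlim : forall eps, 0 < eps -> exists N, r N < eps).
  { intros eps Heps.
    destruct (INR_unbounded (r 0%nat / (c * eps))) as [N HN]; exists N.
    pose proof (gd_gap gam s x N Hgam Es Hs) as H; fold c in H.
    change (h (gd gam x N) - fstar) with (r N) in H.
    assert (H' : INR N * c * r N <= r 0%nat).
    { apply Rle_trans with (h x - h (gd gam x N)); auto.
      unfold r; simpl; pose proof (h_ge (gd gam x N)); lra. }
    apply Rnot_le_lt; intros Hle.
    apply (Rmult_lt_compat_r (c * eps)) in HN; [|pos].
    unfold Rdiv in HN; rewrite Rmult_assoc, Rinv_l in HN by (apply Rgt_not_eq; pos).
    pose proof (pos_INR N).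
    assert (INR N * c * eps <= INR N * c * r N) by (apply Rmult_le_compat_l; auto; pos).
    lra. }
  assert (Hdist : forall j i, nsq p (vsub (gd gam x (j + i)) (gd gam x j)) <= D * r j).
  { intros j i; rewrite gd_plus; set (y := gd gam x j).
    destruct (gd_path_length gam s y i Hgam Es Hs) as [H1 H2].
    eapply Rle_trans; [exact H2|].
    set (m := sqrt (nu / 2)) in *.
    assert (Hm : 0 < m) by (apply sqrt_lt_R0; lra).
    assert (Hm2 : m ^ 2 = nu / 2) by (apply pow2_sqrt; lra).
    pose proof (sqrt_pos (h (gd gam y i) - fstar)).
    assert (Hry : sqrt (h y - fstar) ^ 2 = r j).
    { apply pow2_sqrt; apply Hr0. }
    apply Rle_trans with ((sqrt (h y - fstar) / (s * m)) ^ 2).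
    - apply pow_incr; split.
      + apply Rmult_le_pos; [lra|]; pos.
      + apply Rmult_le_compat_r; [pos|lra].
    - right; unfold Rdiv; rewrite Rpow_mult_distr, Hry, pow_inv, Rpow_mult_distr, Hm2.
      unfold D; field; lra. }
  assert (Hcauchy : forall l, (l < p)%nat -> Cauchy_crit (fun j => gd gam x j l)).
  { intros l Hl eps Heps.
    destruct (Hrlim (/ D * (eps / 2) ^ 2)) as [N HN]; [pos|].
    assert (HDN : D * r N < (eps / 2) ^ 2).
    { apply (Rmult_lt_compat_l D) in HN; auto.
      rewrite <- Rmult_assoc, Rinv_r in HN by lra; lra. }
    assert (Hb : forall j, (j >= N)%nat -> Rabs (gd gam x j l - gd gam x N l) < eps / 2).
    { intros j Hj; replace j with (N + (j - N))%nat by lia.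
      assert (Hsq : (gd gam x (N + (j - N)) l - gd gam x N l) ^ 2 < (eps / 2) ^ 2).
      { eapply Rle_lt_trans; [|exact HDN].
        eapply Rle_trans; [|apply (Hdist N (j - N)%nat)].
        apply (rsum_term_le p (fun l => vsub (gd gam x (N + (j - N))) (gd gam x N) l ^ 2) l);
          auto; intros; apply pow2_ge_0. }
      apply Rnot_le_lt; intros Hle; rewrite <- pow2_abs in Hsq.
      assert (0 < eps / 2) by lra; nra. }
    exists N; intros i j Hi Hj; unfold Rdist.
    replace (gd gam x i l - gd gam x j l) with
      ((gd gam x i l - gd gam x N l) - (gd gam x j l - gd gam x N l)) by ring.
    eapply Rle_lt_trans; [apply Rabs_triang|]; rewrite Rabs_Ropp.
    pose proof (Hb i Hi); pose proof (Hb j Hj); lra. }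
  destruct (finite_choice R 0 (fun l y => Un_cv (fun j => gd gam x j l) y) p) as [y Hy].
  { intros l Hl; destruct (R_complete _ (Hcauchy l Hl)) as [yl Hyl]; now exists yl. }
  assert (Hlim : forall j, nsq p (vsub y (gd gam x j)) <= D * r j).
  { intros j.
    apply (Rle_cv_lim (Un := fun i => nsq p (vsub (gd gam x (j + i)) (gd gam x j)))
             (Vn := fun _ => D * r j)).
    - intros i; apply Hdist.
    - apply (Un_cv_nsq_vsub p (fun i => gd gam x (j + i))); intros l Hl.
      intros eps Heps; destruct (Hy l Hl eps Heps) as [N HN]; exists N; intros i Hi.
      apply HN; lia.
    - apply Un_cv_const. }
  exists y; split.
  - apply Rle_antisym; [|apply Rge_le, h_ge].
    apply Rnot_lt_le; intros Hlt.
    (* The descent inequality from [xN] to [y] serves as continuity of [h]: [C] collects the gap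
       itself, half the squared gradient, half the squared distance and the quadratic term, each a
       multiple of [r N]. *)
    set (C := 1 + K + / 2 * D + K / 2 * D).
    assert (HC : 0 < C) by (assert (0 < K * D) by pos; unfold C; lra).
    destruct (Hrlim ((h y - fstar) / C)) as [N HN]; [apply Rmult_lt_0_compat; [lra|pos]|].
    set (xN := gd gam x N) in *.
    pose proof (h_descent xN (vsub y xN)) as Hd.
    rewrite (h_dep (fun l => xN l + vsub y xN l) y) in Hd by (intros; unfold vsub; ring).
    pose proof (Hlim N) as HlN; fold xN in HlN.
    pose proof (gradient_le_gap xN) as HgN.
    pose proof (dotp_le_quad p 1 (/ 2) (/ 2) (gr xN) (vsub y xN) ltac:(lra) ltac:(lra)) as Hq.
    change (h xN - fstar) with (r N) in HgN.
    assert (HrN : h xN = r N + fstar) by (unfold r; fold xN; ring).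
    apply (Rmult_lt_compat_l C) in HN; auto.
    replace (C * ((h y - fstar) / C)) with (h y - fstar) in HN by (field; lra).
    assert (K / 2 * nsq p (vsub y xN) <= K / 2 * (D * r N)) by (apply Rmult_le_compat_l; lra).
    unfold C in HN; lra.
  - rewrite nsq_vsub_sym; pose proof (Hlim 0%nat) as H; simpl in H.
    unfold D, r in H; simpl in H.
    eapply Rle_trans; [exact H|]; right; field; lra.
Qed.

(** The projection is no farther from [x] than the limit of gradient descent. The step
    [2 (1 - s) / K] realizes any [s] in (0,1), and [s] tends to 1. *)
Lemma quadratic_growth x z :
  is_proj p h fstar x z -> nsq p (vsub x z) <= 2 / nu * (h x - fstar).
Proof.
  intros [_ Hz].
  assert (H : forall s, 0 < s < 1 -> s ^ 2 * nsq p (vsub x z) <= 2 / nu * (h x - fstar)).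
  { intros s Hs.
    destruct (gd_limit (2 * (1 - s) / K) s x) as [y [Hy1 Hy2]];
      [pos | field; lra | lra |].
    pose proof (Hz y Hy1).
    apply Rle_trans with (s ^ 2 * (2 / nu * (h x - fstar) / s ^ 2));
      [apply Rmult_le_compat_l; [pos|lra] | right; field; lra]. }
  set (D := nsq p (vsub x z)) in *; set (b := 2 / nu * (h x - fstar)) in *.
  assert (HD : 0 <= D) by apply nsq_nonneg.
  apply Rnot_lt_le; intros Hlt.
  assert (Hb : 0 <= b) by (unfold b; pose proof (h_ge x); pos).
  (* With this [s], the quantity [s^2 D] is the squared mean of [D] and [b] divided by [D], which
     exceeds [b] when [b < D]. *)
  pose proof (H ((D + b) / (2 * D)) ) as H1.
  assert (Hs : 0 < (D + b) / (2 * D) < 1).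
  { split; [pos|]; apply (Rmult_lt_reg_r (2 * D)); [lra|].
    unfold Rdiv; rewrite Rmult_assoc, Rinv_l by lra; lra. }
  specialize (H1 Hs).
  replace (((D + b) / (2 * D)) ^ 2 * D) with ((D + b) ^ 2 / (4 * D)) in H1 by (field; lra).
  apply (Rmult_le_compat_r (4 * D)) in H1; [|lra].
  replace ((D + b) ^ 2 / (4 * D) * (4 * D)) with ((D + b) ^ 2) in H1 by (field; lra).
  assert (0 < (D - b) ^ 2) by (apply pow_lt; lra); nra.
Qed.

End QuadraticGrowth.

(** * The constants *)

Lemma mul_lt_of_lt_div x y z : 0 < z -> x < y / z -> x * z < y.
Proof.
  intros Hz H; apply (Rmult_lt_compat_r z) in H; auto.
  unfold Rdiv in H; rewrite Rmult_assoc, Rinv_l in H by lra; lra.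
Qed.

Lemma mul_le_of_le_div x y z : 0 < z -> x * z <= y -> x <= y / z.
Proof.
  intros Hz H; apply (Rmult_le_reg_r z); auto.
  unfold Rdiv; rewrite Rmult_assoc, Rinv_l by lra; lra.
Qed.

(* [u] stands for [1 / rho], [t] for [alpha / beta] and [Rmin (u / 2) ((1 - / t) / 2)] for
   [e9]. *)
Lemma eps9_slack t u e8 te :
  1 < t -> 0 < u -> 0 <= te -> / 2 * (1 + t + u) <= e8 ->
  2 * (te * e8) <= u / t -> te * e8 <= / 8 ->
  2 * Rmin (u / 2) ((1 - / t) / 2) * (t + u) <= (1 - te) * (t + u - 1) /\
  4 * Rmin (u / 2) ((1 - / t) / 2) <= Rmin 2 e8 * (1 - te).
Proof.
  intros Ht Hu Hte He8 H1 H2.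
  set (r := / t) in *; assert (Hr : t * r = 1) by (unfold r; field; lra).
  assert (Hr0 : 0 < r) by (unfold r; pos).
  assert (Hr1 : r < 1) by nra.
  unfold Rdiv in H1; fold r in H1.
  (* Since [t r = 1], the product [(1 - r)(t + u)] equals [t + u - 1 - u r]; this inequality is
     exactly the first claim when [(1 - r) / 2] is the minimum. *)
  assert (H3 : te * (t + u - 1) <= u * r).
  { apply Rle_trans with (2 * (te * e8)); auto.
    replace (2 * (te * e8)) with (te * (2 * e8)) by ring.
    apply Rmult_le_compat_l; lra. }
  assert (H4 : te <= / 8).
  { assert (te * 1 <= te * e8) by (apply Rmult_le_compat_l; lra); lra. }
  assert (H5 : te <= r).
  { apply (Rmult_le_reg_l t); [lra|]; rewrite Hr.
    assert (te * (/ 2 * t) <= te * e8) by (apply Rmult_le_compat_l; lra); lra. }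
  (* This is [4 mu <= 7/8 e8] at the crossover [u = 1 - r], with [e8] replaced by its lower bound.
     After multiplication by [t] it is a quadratic of negative discriminant. *)
  assert (Hq : 0 <= 7 * t - 18 + 25 * r).
  { apply (Rmult_le_reg_l t); [lra|].
    replace (t * (7 * t - 18 + 25 * r)) with (7 * t ^ 2 - 18 * t + 25 * (t * r)) by ring.
    rewrite Hr; nra. }
  assert (H7 : 7 / 8 * e8 <= (1 - te) * e8) by (apply Rmult_le_compat_r; lra).
  pose proof (Rmin_l (u / 2) ((1 - r) / 2)) as Hm1.
  pose proof (Rmin_r (u / 2) ((1 - r) / 2)) as Hm2.
  set (mu := Rmin (u / 2) ((1 - r) / 2)) in *.
  split.
  - destruct (Rle_lt_dec (1 - r) u) as [Hc|Hc].
    + assert (2 * mu * (t + u) <= (1 - r) * (t + u)) by (apply Rmult_le_compat_r; lra).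
      nra.
    + assert (2 * mu * (t + u) <= u * (t + u)) by (apply Rmult_le_compat_r; lra).
      assert (0 <= (1 - r - u) * (u + t)) by (apply Rmult_le_pos; lra).
      nra.
  - unfold Rmin; destruct (Rle_dec 2 e8); [lra|].
    destruct (Rle_lt_dec (1 - r) u); lra.
Qed.

Section Constants.

Variables (alpha beta eta Lf nu rho rho2 kappa2 : R).
Hypothesis Lf_pos : Lf > 0.
Hypothesis nu_pos : nu > 0.
Hypothesis rho2_pos' : 0 < rho2.
Hypothesis rho2_le : rho2 <= rho.
Hypothesis beta_gt : beta > c_kappa3 kappa2 rho2.
Hypothesis alpha_gt : beta + c_tkappa1 Lf rho2 < alpha.
Hypothesis eta_pos : 0 < eta.
Hypothesis eta_lt1 : eta < c_teps1 alpha beta Lf rho2 / c_teps2 alpha beta Lf rho.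
Hypothesis eta_lt2 : eta < c_eps3 alpha beta rho2 / c_eps4 beta.
Hypothesis eta_lt3 : eta < c_teps5 alpha beta Lf rho2 / c_teps6 alpha beta Lf rho2.

Lemma beta_pos : 0 < beta.
Proof.
  unfold c_kappa3 in beta_gt; pose proof (sqrt_pos (1 + 8 * kappa2 + 8 / rho2)); lra.
Qed.

Lemma alpha_beta_rho2 : 1 + 9 / 2 * Lf ^ 2 < (alpha - beta) * rho2.
Proof.
  assert (H : c_tkappa1 Lf rho2 * rho2 = 1 + 9 / 2 * Lf ^ 2) by (unfold c_tkappa1; field; lra).
  rewrite <- H; apply Rmult_lt_compat_r; lra.
Qed.

Lemma beta_lt_alpha : beta < alpha.
Proof. pose proof alpha_beta_rho2; nra. Qed.

Lemma alpha_rho_ge1 : 1 <= alpha * rho.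
Proof.
  pose proof alpha_beta_rho2; pose proof beta_lt_alpha; pose proof beta_pos.
  assert ((alpha - beta) * rho2 <= alpha * rho) by (apply Rmult_le_compat; lra).
  nra.
Qed.

Lemma teps2_lower :
  (2 * alpha ^ 2 + beta ^ 2) * rho ^ 2 <= c_teps2 alpha beta Lf rho.
Proof.
  unfold c_teps2; assert (0 <= beta ^ 2 * rho) by (pose proof beta_pos; pos).
  assert (0 <= Lf ^ 2) by pos; lra.
Qed.

Lemma teps2_pos : 0 < c_teps2 alpha beta Lf rho.
Proof.
  pose proof teps2_lower; pose proof beta_pos; pose proof beta_lt_alpha.
  assert (0 < (2 * alpha ^ 2 + beta ^ 2) * rho ^ 2); [|lra].
  apply Rmult_lt_0_compat; [|pos].
  assert (0 < alpha ^ 2) by pos; assert (0 < beta ^ 2) by pos; lra.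
Qed.

Lemma eps4_pos : 0 < c_eps4 beta.
Proof. unfold c_eps4; pose proof (pow2_ge_0 beta); lra. Qed.

Lemma teps6_pos : 0 < c_teps6 alpha beta Lf rho2.
Proof.
  pose proof beta_pos; pose proof beta_lt_alpha; unfold c_teps6.
  assert (0 < / rho2) by pos; assert (0 < alpha / beta) by pos.
  apply Rplus_lt_0_compat; pos.
Qed.

Lemma teps1_gap : 0 < c_teps1 alpha beta Lf rho2 - eta * c_teps2 alpha beta Lf rho.
Proof. pose proof (mul_lt_of_lt_div _ _ _ teps2_pos eta_lt1); lra. Qed.

Lemma eps3_gap : 0 < c_eps3 alpha beta rho2 - eta * c_eps4 beta.
Proof. pose proof (mul_lt_of_lt_div _ _ _ eps4_pos eta_lt2); lra. Qed.

Lemma eps3_lt_beta : c_eps3 alpha beta rho2 < beta.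
Proof.
  pose proof beta_pos; pose proof beta_lt_alpha; unfold c_eps3.
  assert (0 < alpha / (2 * beta ^ 2)) by pos; assert (0 < / (2 * beta * rho2)) by pos; lra.
Qed.

Notation te10 := (c_teps10 alpha beta eta Lf rho rho2 nu).
Notation te := (c_teps alpha beta eta Lf rho rho2 nu).
Notation e8 := (c_eps8 alpha beta rho2).

Lemma teps10_le :
  te10 <= eta * (c_teps1 alpha beta Lf rho2 - eta * c_teps2 alpha beta Lf rho) /\
  te10 <= eta * (c_eps3 alpha beta rho2 - eta * c_eps4 beta) /\
  te10 <= eta * (nu / 4).
Proof.
  unfold c_teps10; set (A := c_teps1 _ _ _ _ - _); set (B := c_eps3 _ _ _ - _).
  pose proof (Rmin_l (Rmin A B) (nu / 4)); pose proof (Rmin_r (Rmin A B) (nu / 4)).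
  pose proof (Rmin_l A B); pose proof (Rmin_r A B).
  repeat split; apply Rmult_le_compat_l; lra.
Qed.

Lemma teps10_pos : 0 < te10.
Proof.
  unfold c_teps10; apply Rmult_lt_0_compat; auto.
  pose proof teps1_gap; pose proof eps3_gap.
  repeat apply Rmin_glb_lt; lra.
Qed.

(** As a function of [eta], the parabola [eta (e3 - eta e4)] has maximum [e3^2 / (4 e4)], where
    [e3 < beta] and [e4 >= 2 beta^2]. *)
Lemma teps10_le_eighth : te10 <= / 8.
Proof.
  destruct teps10_le as [_ [H _]].
  pose proof eps3_lt_beta; pose proof eps3_gap; pose proof beta_pos; pose proof eps4_pos.
  set (e3 := c_eps3 alpha beta rho2) in *.
  assert (He4 : 2 * beta ^ 2 <= c_eps4 beta) by (unfold c_eps4; lra).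
  set (e4 := c_eps4 beta) in *.
  assert (0 < eta * e4) by pos.
  assert (He3 : e3 ^ 2 <= beta ^ 2) by (apply pow_incr; lra).
  assert (Hsq : 4 * (eta * e4) * (e3 - eta * e4) <= e3 ^ 2)
    by (pose proof (pow2_ge_0 (e3 - 2 * (eta * e4))); nra).
  apply (Rmult_le_reg_l (8 * beta ^ 2)); [pos|].
  assert (8 * beta ^ 2 * te10 <= 4 * e4 * te10)
    by (apply Rmult_le_compat_r; [pose proof teps10_pos|]; lra).
  assert (4 * e4 * te10 <= 4 * e4 * (eta * (e3 - eta * e4))) by (apply Rmult_le_compat_l; lra).
  lra.
Qed.

(** Two upper bounds are combined: [te10 <= eta beta], and [eta (2 alpha^2 + beta^2) rho <= alpha -
    beta], the latter from the condition that [eta] is below [c_teps1 / c_teps2]. *)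
Lemma teps10_le_rho : 2 * te10 <= / rho / (alpha / beta).
Proof.
  destruct teps10_le as [_ [H _]].
  pose proof eps3_lt_beta; pose proof beta_pos; pose proof beta_lt_alpha; pose proof eps4_pos.
  assert (Hrho : 0 < rho) by lra.
  assert (Hb : te10 <= eta * beta).
  { assert (0 < eta * c_eps4 beta) by pos.
    apply Rle_trans with (1 := H); apply Rmult_le_compat_l; lra. }
  pose proof (mul_lt_of_lt_div _ _ _ teps2_pos eta_lt1) as Ha.
  assert (Hc : eta * ((2 * alpha ^ 2 + beta ^ 2) * rho ^ 2) <= (alpha - beta) * rho).
  { apply Rle_trans with (c_teps1 alpha beta Lf rho2).
    - apply Rle_trans with (2 := Rlt_le _ _ Ha), Rmult_le_compat_l, teps2_lower; lra.
    - unfold c_teps1; assert (0 <= Lf ^ 2) by pos.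
      assert ((alpha - beta) * rho2 <= (alpha - beta) * rho) by (apply Rmult_le_compat_l; lra).
      lra. }
  assert (Hd : eta * (2 * alpha ^ 2 + beta ^ 2) * rho <= alpha - beta).
  { apply (Rmult_le_reg_r rho); auto; lra. }
  replace (/ rho / (alpha / beta)) with (beta / (rho * alpha)) by (field; lra).
  apply mul_le_of_le_div; [pos|].
  assert (Hs : 0 < 2 * alpha ^ 2 + beta ^ 2) by nra.
  apply (Rmult_le_reg_r (2 * alpha ^ 2 + beta ^ 2)); auto.
  apply Rle_trans with (2 * beta * alpha * (eta * (2 * alpha ^ 2 + beta ^ 2) * rho)).
  - replace (2 * beta * alpha * (eta * (2 * alpha ^ 2 + beta ^ 2) * rho)) with
      (2 * (eta * beta) * (rho * alpha) * (2 * alpha ^ 2 + beta ^ 2)) by ring.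
    repeat (apply Rmult_le_compat_r; [pos|]); lra.
  - apply Rle_trans with (2 * beta * alpha * (alpha - beta)).
    + apply Rmult_le_compat_l; auto; pos.
    + assert (0 < beta * alpha * beta) by pos; assert (0 < beta * beta * beta) by pos; nra.
Qed.

Lemma alpha_div_beta_gt1 : 1 < alpha / beta.
Proof.
  pose proof beta_pos; pose proof beta_lt_alpha.
  apply (Rmult_lt_reg_r beta); auto; unfold Rdiv; rewrite Rmult_assoc, Rinv_l by lra; lra.
Qed.

Lemma eps8_eq : e8 = / 2 * (1 + alpha / beta + / rho2).
Proof. pose proof beta_pos; unfold c_eps8; field; lra. Qed.

Lemma eps8_ge1 : 1 <= e8.
Proof.
  rewrite eps8_eq; pose proof alpha_div_beta_gt1; assert (0 < / rho2) by pos; lra.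
Qed.

Lemma teps_mul_eps8 : te * e8 = te10.
Proof. unfold c_teps; pose proof eps8_ge1; field; lra. Qed.

Lemma teps_pos : 0 < te.
Proof. unfold c_teps; pose proof teps10_pos; pose proof eps8_ge1; apply Rdiv_lt_0_compat; lra. Qed.

Lemma teps_lt1 : te < 1.
Proof.
  pose proof teps_mul_eps8; pose proof teps10_le_eighth; pose proof eps8_ge1.
  pose proof teps_pos.
  assert (te * 1 <= te * e8) by (apply Rmult_le_compat_l; lra); lra.
Qed.

Lemma eps9_bounds :
  2 * c_eps9 alpha beta rho * (alpha / beta + / rho)
    <= (1 - te) * (alpha / beta + / rho - 1) /\
  4 * c_eps9 alpha beta rho <= Rmin 2 e8 * (1 - te).
Proof.
  pose proof beta_pos; pose proof beta_lt_alpha.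
  replace (c_eps9 alpha beta rho) with
    (Rmin (/ rho / 2) ((1 - / (alpha / beta)) / 2))
    by (unfold c_eps9; f_equal; field; lra).
  apply eps9_slack.
  - apply alpha_div_beta_gt1.
  - pos.
  - apply Rlt_le, teps_pos.
  - rewrite eps8_eq; assert (/ rho <= / rho2) by (apply Rinv_le_contravar; lra); lra.
  - rewrite teps_mul_eps8; apply teps10_le_rho.
  - rewrite teps_mul_eps8; apply teps10_le_eighth.
Qed.

Lemma eps9_pos : 0 < c_eps9 alpha beta rho.
Proof.
  pose proof beta_pos; pose proof beta_lt_alpha; unfold c_eps9; apply Rmin_glb_lt; pos.
Qed.

(** The left side is what the increment [d] charges to the squared mean estimate, the right side
    what the descent inequality gains from it. The condition [eta c_teps6 < c_teps5] leaves even
    [eta / 8] in place of [eta / 2]; nonnegativity of the left side then gives the second claim. *)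
Lemma mean_gradient_gap :
  3 * eta ^ 2 * Lf ^ 2 * ((/ beta ^ 2 + / (2 * eta * beta)) * (/ rho2 + alpha / beta)
      + / (2 * eta * beta ^ 2) + / beta ^ 2 + / 2)
  <= eta / 2 - eta ^ 2 * Lf / 2 /\ 0 <= eta / 2 - eta ^ 2 * Lf / 2.
Proof.
  pose proof beta_pos; pose proof beta_lt_alpha.
  pose proof (mul_lt_of_lt_div _ _ _ teps6_pos eta_lt3) as Ha.
  apply (Rmult_lt_compat_l eta) in Ha; auto.
  assert (E : 3 * eta ^ 2 * Lf ^ 2 * ((/ beta ^ 2 + / (2 * eta * beta)) * (/ rho2 + alpha / beta)
      + / (2 * eta * beta ^ 2) + / beta ^ 2 + / 2)
    = eta * (eta * c_teps6 alpha beta Lf rho2) - eta * c_teps5 alpha beta Lf rho2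
      + eta / 8 - eta ^ 2 * Lf / 2)
    by (unfold c_teps5, c_teps6; field; lra).
  assert (Hpos : 0 <= 3 * eta ^ 2 * Lf ^ 2 *
     ((/ beta ^ 2 + / (2 * eta * beta)) * (/ rho2 + alpha / beta)
      + / (2 * eta * beta ^ 2) + / beta ^ 2 + / 2)).
  { assert (0 < / beta ^ 2) by pos; assert (0 < / (2 * eta * beta)) by pos.
    assert (0 < / rho2) by pos; assert (0 < alpha / beta) by pos.
    assert (0 < / (2 * eta * beta ^ 2)) by pos.
    apply Rmult_le_pos; [pos|].
    assert (0 < (/ beta ^ 2 + / (2 * eta * beta)) * (/ rho2 + alpha / beta))
      by (apply Rmult_lt_0_compat; lra).
    lra. }
  lra.
Qed.

End Constants.

(** * The algorithm *)

Definition centered (n : nat) (u : nat -> R) : nat -> R :=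
  fun i => u i - / INR n * rsum n u.

Lemma rsum_centered n u : (1 <= n)%nat -> rsum n (centered n u) = 0.
Proof.
  intros Hn; assert (0 < INR n) by (apply lt_0_INR; lia).
  unfold centered; rewrite rsum_minus, rsum_const; field; lra.
Qed.

Lemma nsq_centered n u :
  (1 <= n)%nat -> nsq n (centered n u) = nsq n u - / INR n * rsum n u ^ 2.
Proof.
  intros Hn; assert (0 < INR n) by (apply lt_0_INR; lia).
  set (s := / INR n * rsum n u).
  rewrite (nsq_ext n (centered n u) (fun i => u i + - s * 1))
    by (intros; unfold centered, s; ring).
  rewrite (nsq_plus n u (fun _ => - s * 1)), dotp_scal_r, nsq_scal.
  unfold dotp, nsq at 2; rewrite rsum_const.
  rewrite (rsum_ext n (fun l => u l * 1) u) by (intros; ring).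
  unfold s; field; lra.
Qed.

Lemma nsq_centered_le n u : (1 <= n)%nat -> nsq n (centered n u) <= nsq n u.
Proof.
  intros Hn; rewrite nsq_centered by auto.
  assert (0 < INR n) by (apply lt_0_INR; lia).
  assert (0 <= / INR n * rsum n u ^ 2) by (apply Rmult_le_pos; [pos|apply pow2_ge_0]); lra.
Qed.

Lemma jensen_sq n u : (1 <= n)%nat -> INR n * (/ INR n * rsum n u) ^ 2 <= nsq n u.
Proof.
  intros Hn; pose proof (nsq_nonneg n (centered n u)) as H.
  rewrite nsq_centered in H by auto; assert (0 < INR n) by (apply lt_0_INR; lia).
  replace (INR n * (/ INR n * rsum n u) ^ 2) with (/ INR n * rsum n u ^ 2) by (field; lra).
  lra.
Qed.

Lemma snsq_swap n p z : snsq n p z = rsum p (fun l => nsq n (fun i => z i l)).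
Proof. unfold snsq, nsq; apply (rsum_swap n p (fun i l => z i l ^ 2)). Qed.

Lemma Knsq_centered n p z :
  (1 <= n)%nat -> Knsq n p z = rsum p (fun l => nsq n (centered n (fun i => z i l))).
Proof.
  intros Hn; unfold Knsq; rewrite rsum_swap; apply rsum_ext; intros l _.
  rewrite nsq_centered by auto; unfold nsq, avgv.
  rewrite (rsum_ext n _ (fun i => z i l ^ 2 - / INR n * rsum n (fun i => z i l) * z i l))
    by (intros; ring).
  rewrite rsum_minus, rsum_scal; ring.
Qed.

Lemma rmaxn_bounds m u b :
  (1 <= m)%nat -> (forall i, (i < m)%nat -> 0 < u i <= b) -> 0 < rmaxn m u <= b.
Proof.
  induction m as [|[|m] IH]; intros Hm H; [lia| |].
  - apply (H 0%nat); lia.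
  - assert (H1 : 0 < rmaxn (S m) u <= b) by (apply IH; [lia|]; intros; apply H; lia).
    assert (H2 : 0 < u (S m) <= b) by (apply H; lia).
    change (rmaxn (S (S m)) u) with (Rmax (rmaxn (S m) u) (u (S m))).
    unfold Rmax; destruct (Rle_dec _ _); lra.
Qed.

Lemma nsq_vsub_split2 m a b c :
  nsq m (vsub a c) <= 2 * nsq m (vsub a b) + 2 * nsq m (vsub b c).
Proof.
  unfold nsq, vsub; rewrite <- !rsum_scal, <- rsum_plus; apply rsum_le; intros i _.
  pose proof (pow2_ge_0 (a i - 2 * b i + c i)); nra.
Qed.

(** The small factor 2 falls on the gradient difference, which is charged to [ysum] through [Lf^2];
    the estimation errors can afford 4. An even split would leave no room for a weight 2 on the
    gap. *)
Lemma nsq_vsub_split3 m a b c d :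
  nsq m (vsub a b) <= 2 * nsq m (vsub c d) + 4 * nsq m (vsub a c) + 4 * nsq m (vsub b d).
Proof.
  unfold nsq, vsub; rewrite <- !rsum_scal, <- !rsum_plus; apply rsum_le; intros i _.
  pose proof (pow2_ge_0 ((c i - d i) - ((a i - c i) - (b i - d i)))).
  pose proof (pow2_ge_0 ((a i - c i) + (b i - d i))); nra.
Qed.

Lemma nsq_vsub_split3_even m a b c d :
  nsq m (vsub a b) <= 3 * (nsq m (vsub c d) + nsq m (vsub a c) + nsq m (vsub b d)).
Proof.
  unfold nsq, vsub; rewrite <- !rsum_plus, <- rsum_scal; apply rsum_le; intros i _.
  set (u := c i - d i); set (s := a i - c i); set (t := b i - d i).
  replace (a i - b i) with (u + s - t) by (unfold u, s, t; ring).
  pose proof (pow2_ge_0 (u - s)); pose proof (pow2_ge_0 (u + t)); pose proof (pow2_ge_0 (s + t)).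
  nra.
Qed.

Lemma Rpower_half_sq b k d :
  0 < b -> 0 < d <= Rpower b (INR k / 2) -> d ^ 2 <= b ^ k.
Proof.
  intros Hb Hd; rewrite <- (Rpower_pow k b) by auto.
  replace (Rpower b (INR k)) with (Rpower b (INR k / 2) ^ 2).
  - apply pow_incr; lra.
  - replace (INR k) with (INR k / 2 + INR k / 2) at 2 by field.
    rewrite Rpower_plus; ring.
Qed.

(** The convolution of the powers of [c] and [b], that is, the sum of [c^(k-1-j) b^j] over [j < k]:
    the accumulated response of a contraction [c] to noise [b^j]. *)
Fixpoint geosum (c b : R) (k : nat) : R :=
  match k with
  | O => 0
  | S k' => c * geosum c b k' + b ^ k'
  end.

Lemma geosum_eq c b k : geosum c b k * (c - b) = c ^ k - b ^ k.
Proof. induction k as [|k IH]; simpl; [ring|]. rewrite Rmult_plus_distr_r, Rmult_assoc, IH; ring. Qed.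

Lemma geosum_nonneg c b k : 0 <= c -> 0 <= b -> 0 <= geosum c b k.
Proof.
  intros Hc Hb; induction k as [|k IH]; simpl; [lra|].
  apply Rplus_le_le_0_compat; [now apply Rmult_le_pos|now apply pow_le].
Qed.

(** With equal ratios the sum is [k b^(k-1)], not geometric; any larger ratio [d] dominates it. *)
Lemma geosum_diag b d k : 0 <= b -> b < d -> geosum b b k * (d - b) <= d ^ k.
Proof.
  intros Hb Hd; induction k as [|k IH]; simpl; [lra|].
  assert (b ^ k <= d ^ k) by (apply pow_incr; lra); nra.
Qed.

Lemma geosum_le_phi e11 e12 te b d k :
  0 <= e11 -> 0 <= e12 -> 0 < te -> 0 < 1 - te -> 0 < b < 1 -> b < d ->
  (1 - te) * ((e11 + e12 * b) * geosum (1 - te) b k) <= phi e11 e12 te b d k.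
Proof.
  intros H11 H12 Hte Hc Hb Hd.
  pose proof (geosum_nonneg (1 - te) b k ltac:(lra) ltac:(lra)) as Hk.
  assert (Hbk : 0 < b ^ k) by (apply pow_lt; lra).
  (* The additional factor [1 - te] is traded for one more term, which matches the exponent [k + 1]
     in [phi]. *)
  assert (Hmono : (1 - te) * geosum (1 - te) b k <= geosum (1 - te) b (S k)) by (simpl; lra).
  assert (Hcoef : e11 + e12 * b <= e11 / (1 - te) + e12).
  { assert (e11 <= e11 / (1 - te)) by (apply mul_le_of_le_div; nra); nra. }
  assert (Hcoef0 : 0 <= e11 + e12 * b) by nra.
  unfold phi; rewrite Nat.add_1_r.
  apply Rle_trans with ((e11 + e12 * b) * geosum (1 - te) b (S k)); [nra|].
  apply Rmult_le_compat; auto; [apply geosum_nonneg; lra|].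
  pose proof (geosum_eq (1 - te) b (S k)) as E.
  pose proof (pow_lt (1 - te) (S k) Hc); pose proof (pow_lt b (S k) ltac:(lra)).
  destruct (Rlt_dec b (1 - te)); [|destruct (Rlt_dec (1 - te) b)].
  - apply mul_le_of_le_div; lra.
  - apply mul_le_of_le_div; lra.
  - replace (1 - te) with b by lra.
    apply mul_le_of_le_div; [lra|]; apply geosum_diag; lra.
Qed.

Section Algorithm.

Variables (n p : nat) (a : nat -> nat -> R) (f : nat -> vec -> R) (g : nat -> vec -> vec).
Variables (fstar Lf nu rho rho2 kappa2 alpha beta eta he : R).
Variables (delta : nat -> nat -> R) (x v : nat -> nat -> vec).
Hypothesis Ha_nonneg : forall i j, (i < n)%nat -> (j < n)%nat -> a i j >= 0.
Hypothesis Ha_sym : forall i j, (i < n)%nat -> (j < n)%nat -> a i j = a j i.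
Hypothesis HA1 : connected n a.
Hypothesis Hrho : is_largest_eig n (laplacian n a) rho.
Hypothesis Hrho2 : is_smallest_pos_eig n (laplacian n a) rho2.
Hypothesis Hfp : forall i, (i < n)%nat -> dep_p p (f i).
Hypothesis Hgrad : forall i, (i < n)%nat -> is_gradient p (f i) (g i).
Hypothesis HA2_min : forall y, favg n f y >= fstar.
Hypothesis HLf : Lf > 0.
Hypothesis HA3 : forall i, (i < n)%nat -> forall y z,
  sqrt (nsq p (vsub (g i y) (g i z))) <= Lf * sqrt (nsq p (vsub y z)).
Hypothesis Hnu : nu > 0.
Hypothesis HA4 : forall y, / 2 * nsq p (gavg n g y) >= nu * (favg n f y - fstar).
Hypothesis Hbeta : beta > c_kappa3 kappa2 rho2.
Hypothesis Halpha : beta + c_tkappa1 Lf rho2 < alpha.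
Hypothesis Heta : 0 < eta.
Hypothesis Heta1 : eta < c_teps1 alpha beta Lf rho2 / c_teps2 alpha beta Lf rho.
Hypothesis Heta2 : eta < c_eps3 alpha beta rho2 / c_eps4 beta.
Hypothesis Heta3 : eta < c_teps5 alpha beta Lf rho2 / c_teps6 alpha beta Lf rho2.
Hypothesis Hhe : 0 < he.
Hypothesis Hhe1 : he < 1.
Hypothesis Hdelta : forall i k, (i < n)%nat -> 0 < delta i k <= Rpower he (INR k / 2).
Hypothesis Hv0 : forall l, (l < p)%nat -> rsum n (fun j => v j O l) = 0.
Hypothesis Hx : forall i k l, (i < n)%nat -> (l < p)%nat ->
  x i (S k) l = x i k l - eta * (alpha * rsum n (fun j => laplacian n a i j * x j k l)
                                 + beta * v i k l
                                 + hatgrad p (f i) (x i k) (delta i k) l).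
Hypothesis Hv : forall i k l, (i < n)%nat -> (l < p)%nat ->
  v i (S k) l = v i k l + eta * beta * rsum n (fun j => laplacian n a i j * x j k l).

Notation L := (laplacian n a).

Let Hn : (1 <= n)%nat.
Proof. eapply laplacian_dim; eauto. Qed.
Let Hrho2pos : 0 < rho2.
Proof. eapply rho2_pos; eauto. Qed.
Let Hrho2le : rho2 <= rho.
Proof. eapply rho2_le_rho; eauto. Qed.
Let Hnpos : 0 < INR n.
Proof. eapply INR_dim_pos; eauto. Qed.
Let Hbpos : 0 < beta.
Proof. eapply beta_pos; eauto. Qed.
Let Hbalpha : beta < alpha.
Proof. apply (beta_lt_alpha alpha beta Lf rho2); auto. Qed.

Definition xbar k := avgv n (fun i => x i k).
(** One radius for all agents, still subject to the decay bound; at [k = 0] it is the radius in the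
    definition of the initial constant. *)
Definition dmax k := rmaxn n (fun i => delta i k).
Definition hx k i := hatgrad p (f i) (x i k) (delta i k).
Definition hbar k i := hatgrad p (f i) (xbar k) (dmax k).
(** The coordinate [l] comes before the agent: for fixed [l] these are vectors over the agents, to
    which the scalar Laplacian and Lyapunov estimates apply. The Kronecker factor becomes a sum over
    [l]. *)
Definition yc k l := centered n (fun i => x i k l).
Definition wc k l := centered n (fun i => v i k l + / beta * hbar k i l).
Definition ec k l := centered n (fun i => hx k i l - hbar k i l).
Definition dc k l := centered n (fun i => hbar (S k) i l - hbar k i l).
Definition havg k := avgv n (hx k).

Lemma mv_centered u i : (i < n)%nat -> mv n L (centered n u) i = mv n L u i.
Proof.
  intros Hi; rewrite (mv_ext n L _ (fun j => u j + -1 * (/ INR n * rsum n u)))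
    by (intros; unfold centered; ring).
  rewrite (mv_plus n L u (fun _ => -1 * (/ INR n * rsum n u))), laplacian_const; auto; ring.
Qed.

(** The Laplacian preserves the zero sum of the initial dual variables, so these drop out of the
    dynamics of the mean. *)
Lemma rsum_dual k l : (l < p)%nat -> rsum n (fun i => v i k l) = 0.
Proof.
  intros Hl; induction k as [|k IH]; [now apply Hv0|].
  rewrite (rsum_ext n _ (fun i => v i k l + eta * beta * mv n L (fun j => x j k l) i))
    by (intros; now apply Hv).
  rewrite rsum_plus, rsum_scal, IH, (rsum_mv_laplacian n a Ha_sym); ring.
Qed.

(** [beta v + hx] is regrouped as [beta (v + hbar / beta) + (hx - hbar)] before centering. *)
Lemma yc_step k l i : (l < p)%nat -> (i < n)%nat ->
  yc (S k) l i = yc k l i + - eta * (alpha * mv n L (yc k l) i + (beta * wc k l i + ec k l i)).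
Proof.
  intros Hl Hi; unfold yc at 3; rewrite mv_centered by auto.
  unfold yc, wc, ec, centered.
  rewrite (rsum_ext n (fun i => x i (S k) l) (fun i => x i k l + - eta *
    (alpha * mv n L (fun j => x j k l) i + (beta * v i k l + hx k i l))))
    by (intros; rewrite Hx by auto; unfold hx, mv; ring).
  rewrite Hx by auto; fold (hx k i); fold (mv n L (fun j => x j k l) i).
  rewrite !rsum_plus, rsum_minus, !rsum_scal, !rsum_plus, !rsum_scal, rsum_dual by auto.
  rewrite (rsum_mv_laplacian n a Ha_sym).
  field; lra.
Qed.

Lemma wc_step k l i : (l < p)%nat -> (i < n)%nat ->
  wc (S k) l i = wc k l i + (eta * beta * mv n L (yc k l) i + / beta * dc k l i).
Proof.
  intros Hl Hi; unfold yc; rewrite mv_centered by auto.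
  unfold wc, dc, centered.
  rewrite !rsum_plus, rsum_minus, !rsum_scal, !rsum_dual by auto.
  rewrite Hv by auto; fold (mv n L (fun j => x j k l) i); ring.
Qed.

Definition ysum k := rsum p (fun l => nsq n (yc k l)).
Definition wsum k := rsum p (fun l => nsq n (wc k l)).
Definition gap k := INR n * (favg n f (xbar k) - fstar).
Definition noise := 3 * INR n * INR p * Lf ^ 2 / 4.

Lemma ysum_snsq k : ysum k = snsq n p (fun i => vsub (x i k) (xbar k)).
Proof. rewrite snsq_swap; reflexivity. Qed.

(** * Errors and increments of the gradient estimates *)

Lemma delta_sq_le i k : (i < n)%nat -> delta i k ^ 2 <= he ^ k.
Proof. intros Hi; apply Rpower_half_sq; auto. Qed.

Lemma dmax_bounds k : 0 < dmax k <= Rpower he (INR k / 2).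
Proof. apply rmaxn_bounds; auto. Qed.

Lemma dmax_sq_le k : dmax k ^ 2 <= he ^ k.
Proof. apply Rpower_half_sq; auto using dmax_bounds. Qed.

Lemma hatgrad_error_pow i d y k : (i < n)%nat -> 0 < d -> d ^ 2 <= he ^ k ->
  nsq p (vsub (hatgrad p (f i) y d) (g i y)) <= INR p * (Lf ^ 2 * he ^ k / 4).
Proof.
  intros Hi Hd Hdk.
  eapply Rle_trans; [apply (hatgrad_error p (f i) (g i) Lf); auto|].
  apply Rmult_le_compat_l; [apply pos_INR|].
  assert (0 <= Lf ^ 2) by pos; nra.
Qed.

Lemma hx_error i k : (i < n)%nat ->
  nsq p (vsub (hx k i) (g i (x i k))) <= INR p * (Lf ^ 2 * he ^ k / 4).
Proof. intros Hi; apply hatgrad_error_pow; auto using delta_sq_le; apply Hdelta; auto. Qed.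

Lemma hbar_error i k : (i < n)%nat ->
  nsq p (vsub (hbar k i) (g i (xbar k))) <= INR p * (Lf ^ 2 * he ^ k / 4).
Proof. intros Hi; apply hatgrad_error_pow; auto using dmax_sq_le; apply dmax_bounds. Qed.

Lemma ec_bound k :
  rsum p (fun l => nsq n (ec k l)) <= 2 * Lf ^ 2 * ysum k + 8 / 3 * noise * he ^ k.
Proof.
  apply Rle_trans with (snsq n p (fun i => vsub (hx k i) (hbar k i))).
  { rewrite snsq_swap; apply rsum_le; intros l Hl; apply nsq_centered_le; auto. }
  rewrite ysum_snsq; unfold snsq.
  apply Rle_trans with (rsum n (fun i => 2 * Lf ^ 2 * nsq p (vsub (x i k) (xbar k))
     + 2 * INR p * Lf ^ 2 * he ^ k)).
  - apply rsum_le; intros i Hi.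
    pose proof (nsq_vsub_split3 p (hx k i) (hbar k i) (g i (x i k)) (g i (xbar k))).
    pose proof (nsq_gradient_lipschitz p (g i) Lf (HA3 i Hi) (x i k) (xbar k)).
    pose proof (hx_error i k Hi); pose proof (hbar_error i k Hi); lra.
  - rewrite rsum_plus, rsum_scal, rsum_const; unfold noise; lra.
Qed.

Lemma xbar_step k l : (l < p)%nat -> xbar (S k) l = xbar k l + - eta * havg k l.
Proof.
  intros Hl; unfold xbar, havg, avgv.
  rewrite (rsum_ext n (fun i => x i (S k) l) (fun i => x i k l + - eta *
    (alpha * mv n L (fun j => x j k l) i + (beta * v i k l + hx k i l))))
    by (intros; rewrite Hx by auto; unfold hx, mv; ring).
  rewrite !rsum_plus, !rsum_scal, !rsum_plus, !rsum_scal, rsum_dual by auto.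
  rewrite (rsum_mv_laplacian n a Ha_sym); ring.
Qed.

(** The mean moves by [- eta havg], so the Lipschitz condition controls the gradients at consecutive
    means. The even split gives the factor 3 required by [mean_gradient_gap] and by the
    normalization of [noise]. *)
Lemma dc_bound k :
  rsum p (fun l => nsq n (dc k l))
  <= 3 * eta ^ 2 * Lf ^ 2 * (INR n * nsq p (havg k)) + noise * (he ^ k + he ^ S k).
Proof.
  apply Rle_trans with (snsq n p (fun i => vsub (hbar (S k) i) (hbar k i))).
  { rewrite snsq_swap; apply rsum_le; intros l Hl; apply nsq_centered_le; auto. }
  unfold snsq.
  apply Rle_trans with (rsum n (fun _ => 3 * (Lf ^ 2 * (eta ^ 2 * nsq p (havg k))
     + INR p * (Lf ^ 2 * he ^ S k / 4) + INR p * (Lf ^ 2 * he ^ k / 4)))).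
  - apply rsum_le; intros i Hi.
    pose proof (nsq_vsub_split3_even p (hbar (S k) i) (hbar k i) (g i (xbar (S k)))
      (g i (xbar k))).
    pose proof (nsq_gradient_lipschitz p (g i) Lf (HA3 i Hi) (xbar (S k)) (xbar k)) as HL.
    rewrite (nsq_ext p (vsub (xbar (S k)) (xbar k)) (fun l => - eta * havg k l)) in HL
      by (intros; unfold vsub; rewrite xbar_step by auto; ring).
    rewrite nsq_scal in HL.
    pose proof (hbar_error i k Hi); pose proof (hbar_error i (S k) Hi); lra.
  - rewrite rsum_const; unfold noise; right; field.
Qed.

(** * Descent of the optimality gap *)

Lemma favg_dep : dep_p p (favg n f).
Proof.
  intros y z H; unfold favg; f_equal; apply rsum_ext; intros i Hi; now apply (Hfp i Hi).
Qed.

Lemma favg_descent y z :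
  favg n f (fun l => y l + z l) <= favg n f y + dotp p (gavg n g y) z + Lf / 2 * nsq p z.
Proof.
  assert (Hdot : dotp p (gavg n g y) z = / INR n * rsum n (fun i => dotp p (g i y) z)).
  { unfold dotp, gavg; rewrite rsum_swap, <- rsum_scal; apply rsum_ext; intros l _.
    rewrite (rsum_ext n (fun i => g i y l * z l) (fun i => z l * g i y l)) by (intros; ring).
    rewrite rsum_scal; ring. }
  rewrite Hdot; unfold favg.
  replace (Lf / 2 * nsq p z) with (/ INR n * rsum n (fun _ => Lf / 2 * nsq p z))
    by (rewrite rsum_const; field; lra).
  rewrite <- !Rmult_plus_distr_l, <- !rsum_plus.
  apply Rmult_le_compat_l; [pos|]; apply rsum_le; intros i Hi.
  pose proof (smooth_bound p (f i) (g i) Lf (Hfp i Hi) (Hgrad i Hi) HLf (HA3 i Hi) y z) as H.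
  pose proof (Rle_abs (f i (fun l => y l + z l) - f i y - dotp p (g i y) z)); lra.
Qed.

Lemma havg_error k :
  INR n * nsq p (vsub (havg k) (gavg n g (xbar k)))
  <= 2 * Lf ^ 2 * ysum k + 2 / 3 * noise * he ^ k.
Proof.
  apply Rle_trans with (snsq n p (fun i => vsub (hx k i) (g i (xbar k)))).
  { rewrite snsq_swap; unfold nsq at 1; rewrite <- rsum_scal; apply rsum_le; intros l Hl.
    eapply Rle_trans; [|apply jensen_sq; auto].
    right; unfold vsub, havg, avgv, gavg; rewrite rsum_minus; ring. }
  rewrite ysum_snsq; unfold snsq.
  apply Rle_trans with (rsum n (fun i => 2 * Lf ^ 2 * nsq p (vsub (x i k) (xbar k))
     + INR p * Lf ^ 2 * he ^ k / 2)).
  - apply rsum_le; intros i Hi.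
    pose proof (nsq_vsub_split2 p (hx k i) (g i (x i k)) (g i (xbar k))).
    pose proof (nsq_gradient_lipschitz p (g i) Lf (HA3 i Hi) (x i k) (xbar k)).
    pose proof (hx_error i k Hi); lra.
  - rewrite rsum_plus, rsum_scal, rsum_const; unfold noise; lra.
Qed.

Lemma gap_nonneg k : 0 <= gap k.
Proof. unfold gap; pose proof (HA2_min (xbar k)); pos. Qed.

Lemma gap_step k :
  gap (S k) <= gap k - eta * nu * gap k
    - (eta / 2 - eta ^ 2 * Lf / 2) * (INR n * nsq p (havg k))
    + eta * Lf ^ 2 * ysum k + eta / 3 * noise * he ^ k.
Proof.
  unfold gap; rewrite (favg_dep (xbar (S k)) (fun l => xbar k l + - eta * havg k l))
    by (intros; now apply xbar_step).
  pose proof (favg_descent (xbar k) (fun l => - eta * havg k l)) as H.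
  rewrite dotp_scal_r, nsq_scal in H.
  pose proof (HA4 (xbar k)) as HPL; pose proof (havg_error k) as HE.
  set (G := gavg n g (xbar k)) in *.
  (* Polarization replaces the product in the descent inequality by squares: that of [G] feeds the
     PL inequality, that of [havg] is kept to pay for [d], and that of the difference is the error
     just bounded. *)
  assert (Hp : nsq p (vsub (havg k) G) = nsq p (havg k) - 2 * dotp p G (havg k) + nsq p G).
  { rewrite (nsq_ext p _ (fun l => havg k l + -1 * G l)) by (intros; unfold vsub; ring).
    rewrite (nsq_plus p (havg k) (fun l => -1 * G l)), dotp_scal_r, nsq_scal, (dotp_sym p G).
    ring. }
  rewrite Hp in HE.
  apply (Rmult_le_compat_l (INR n)) in H; [|lra].
  apply (Rmult_le_compat_l (eta / 2)) in HE; [|lra].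
  assert (HPL' : eta * INR n * (nu * (favg n f (xbar k) - fstar))
    <= eta * INR n * (/ 2 * nsq p G)) by (apply Rmult_le_compat_l; [pos|lra]).
  lra.
Qed.

(** * The merit function and its contraction *)

Variable Q : nat -> nat -> R.
Hypothesis HQsym : symmetric n Q.
Hypothesis HQpsd : psd n Q.
Hypothesis HQinv : forall y i, rsum n y = 0 -> (i < n)%nat -> mv n Q (mv n L y) i = y i.
Hypothesis HQbounds : forall w, rsum n w = 0 ->
  / rho * nsq n w <= dotp n w (mv n Q w) <= / rho2 * nsq n w.

Notation e8 := (c_eps8 alpha beta rho2).
Notation e9 := (c_eps9 alpha beta rho).
Notation e11 := (c_eps11 n p alpha beta eta Lf rho2).
Notation e12 := (c_eps12 n p alpha beta eta Lf rho2).
Notation te := (c_teps alpha beta eta Lf rho rho2 nu).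
Notation te10 := (c_teps10 alpha beta eta Lf rho rho2 nu).

Definition lyap_sum k := rsum p (fun l => lyap n Q alpha beta (yc k l) (wc k l)).

(* The paper's Lyapunov function has weight 1 on the optimality gap. The larger weight is
   still below [e8], and the slack in the constants absorbs it; it is what the bound on the
   distance to the set of minimizers needs. *)
Definition merit k := lyap_sum k + Rmin 2 e8 * gap k.

(** [e8] is the total weight of [w] once [y.w] is split evenly; for [y] the same split gives 1,
    which is at most [e8]. *)
Lemma lyap_le_eps8 y w : rsum n w = 0 ->
  lyap n Q alpha beta y w <= e8 * nsq n y + e8 * nsq n w.
Proof.
  intros Hw; destruct (HQbounds w Hw) as [_ H]; unfold lyap.
  pose proof (dotp_le_quad n 1 (/ 2) (/ 2) y w ltac:(lra) ltac:(lra)).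
  pose proof (eps8_ge1 alpha beta Lf rho2 kappa2 HLf Hrho2pos Hbeta Halpha) as H8.
  assert (H8y : 1 * nsq n y <= e8 * nsq n y) by (apply Rmult_le_compat_r; auto using nsq_nonneg).
  assert (E : e8 * nsq n w
    = / 2 * (/ rho2 * nsq n w) + alpha / (2 * beta) * nsq n w + / 2 * nsq n w)
    by (unfold c_eps8; field; lra).
  lra.
Qed.

(** The lower bound on [Q] gives [w] the weight [c / 2] with [c = alpha / beta + / rho]. Minimizing
    over [w] leaves [(1 - / c) / 2] for [y], and the first bound of [eps9_bounds] compares this with
    [e9]. *)
Lemma lyap_ge_eps9 y w : rsum n w = 0 ->
  e9 * nsq n y <= (1 - te) * lyap n Q alpha beta y w.
Proof.
  intros Hw; destruct (HQbounds w Hw) as [H _].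
  pose proof (teps_lt1 alpha beta eta Lf nu rho rho2 kappa2) as Hte.
  destruct (eps9_bounds alpha beta eta Lf nu rho rho2 kappa2) as [H9 _]; auto.
  assert (Hir : 0 < / rho) by (apply Rinv_0_lt_compat; lra).
  pose proof (alpha_div_beta_gt1 alpha beta Lf rho2 kappa2) as Ht.
  set (t := alpha / beta) in *; set (u := / rho) in *.
  assert (Ht1 : 1 < t) by auto; assert (Hte1 : te < 1) by auto.
  set (c := t + u) in *; assert (Hc : 1 < c) by (unfold c; lra).
  pose proof (dotp_le_quad n (-1) (/ (2 * c)) (c / 2) y w ltac:(pos)
    ltac:(right; field; lra)) as Hq.
  assert (Hlow : (/ 2 - / (2 * c)) * nsq n y <= lyap n Q alpha beta y w).
  { unfold lyap; replace (alpha / (2 * beta)) with (/ 2 * t) by (unfold t; field; lra).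
    unfold c at 2 in Hq; lra. }
  apply Rle_trans with ((1 - te) * ((/ 2 - / (2 * c)) * nsq n y));
    [|apply Rmult_le_compat_l; lra].
  rewrite <- Rmult_assoc; apply Rmult_le_compat_r; [apply nsq_nonneg|].
  apply (Rmult_le_reg_r (2 * c)); [lra|].
  replace ((1 - te) * (/ 2 - / (2 * c)) * (2 * c)) with ((1 - te) * (c - 1)) by (field; lra).
  lra.
Qed.

Lemma rsum_wc k l : rsum n (wc k l) = 0.
Proof. apply rsum_centered; auto. Qed.

Lemma rsum_yc k l : rsum n (yc k l) = 0.
Proof. apply rsum_centered; auto. Qed.

Notation dcoef := ((/ beta ^ 2 + / (2 * eta * beta)) * (/ rho2 + alpha / beta)
      + / (2 * eta * beta ^ 2) + / beta ^ 2 + / 2).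

Lemma lyap_sum_step k :
  lyap_sum (S k) <= lyap_sum k
  - eta * ((alpha - beta) * rho2 - 1 - eta * (/ 2 * beta ^ 2 * rho + 2 * alpha ^ 2 * rho ^ 2))
      * ysum k
  - eta * (beta - / 2 - / (2 * beta) * (/ rho2 + alpha / beta) - eta * (2 * beta ^ 2)) * wsum k
  + (eta + 7 / 4 * eta ^ 2) * rsum p (fun l => nsq n (ec k l))
  + dcoef * rsum p (fun l => nsq n (dc k l)).
Proof.
  unfold lyap_sum, ysum, wsum.
  rewrite <- !rsum_scal, <- !rsum_minus, <- !rsum_plus; apply rsum_le; intros l Hl.
  apply (lyap_step n L); auto using yc_step, wc_step.
  - apply (alpha_rho_ge1 alpha beta Lf rho rho2 kappa2); auto.
  - intros; apply HQinv; auto using rsum_yc.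
  - apply HQbounds, rsum_wc.
  - apply HQbounds; apply rsum_centered; auto.
  - apply (laplacian_ge_rho2 n a Ha_nonneg Ha_sym HA1 rho rho2 Hrho Hrho2), rsum_yc.
  - apply laplacian_le_rho; auto.
  - apply (nsq_mv_laplacian n a Ha_nonneg Ha_sym rho rho2); auto.
Qed.

Lemma ysum_nonneg k : 0 <= ysum k.
Proof. apply rsum_nonneg; intros; apply nsq_nonneg. Qed.

Lemma wsum_nonneg k : 0 <= wsum k.
Proof. apply rsum_nonneg; intros; apply nsq_nonneg. Qed.

Lemma merit_le k : merit k <= e8 * (ysum k + wsum k + gap k).
Proof.
  unfold merit.
  assert (H : lyap_sum k <= e8 * ysum k + e8 * wsum k).
  { unfold lyap_sum, ysum, wsum; rewrite <- !rsum_scal, <- rsum_plus; apply rsum_le.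
    intros l _; apply lyap_le_eps8, rsum_wc. }
  assert (Rmin 2 e8 * gap k <= e8 * gap k)
    by (apply Rmult_le_compat_r; [apply gap_nonneg|apply Rmin_r]).
  lra.
Qed.

Lemma merit_ge k :
  e9 * (ysum k + 4 * gap k) <= (1 - te) * merit k.
Proof.
  unfold merit.
  assert (H : e9 * ysum k <= (1 - te) * lyap_sum k).
  { unfold lyap_sum, ysum; rewrite <- !rsum_scal; apply rsum_le.
    intros l _; apply lyap_ge_eps9, rsum_wc. }
  destruct (eps9_bounds alpha beta eta Lf nu rho rho2 kappa2) as [_ H9]; auto.
  apply (Rmult_le_compat_r (gap k)) in H9; [|apply gap_nonneg]; lra.
Qed.

Lemma noise_nonneg : 0 <= noise.
Proof. unfold noise; assert (0 <= INR p) by apply pos_INR; pos. Qed.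

Lemma dcoef_pos : 0 < dcoef.
Proof.
  assert (0 < / beta ^ 2) by pos; assert (0 < / (2 * eta * beta)) by pos.
  assert (0 < / rho2) by pos; assert (0 < alpha / beta) by pos.
  assert (0 < / (2 * eta * beta ^ 2)) by pos.
  assert (0 < (/ beta ^ 2 + / (2 * eta * beta)) * (/ rho2 + alpha / beta))
    by (apply Rmult_lt_0_compat; lra).
  lra.
Qed.

(** The first-order charges to [ysum] total at most [4 eta Lf^2], against [9/2] reserved in
    [c_teps1]. The noise outside [dcoef] totals at most [10/3 eta + 14/3 eta^2], against
    [15/4 eta + 5 eta^2] in [e11]. The squared mean estimate is absorbed by [mean_gradient_gap]. *)
Lemma merit_step k : merit (S k) <= (1 - te) * merit k + e11 * he ^ k + e12 * he ^ S k.
Proof.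
  assert (Htm : te * merit k <= te10 * (ysum k + wsum k + gap k)).
  { rewrite <- (teps_mul_eps8 alpha beta eta Lf nu rho rho2 kappa2) by auto.
    rewrite Rmult_assoc; apply Rmult_le_compat_l; [|apply merit_le].
    apply Rlt_le, (teps_pos alpha beta eta Lf nu rho rho2 kappa2); auto. }
  destruct (teps10_le alpha beta eta Lf nu rho rho2 Heta) as [T1 [T2 T3]].
  pose proof (eps8_ge1 alpha beta Lf rho2 kappa2 HLf Hrho2pos Hbeta Halpha) as H8.
  destruct (mean_gradient_gap alpha beta eta Lf rho2 kappa2) as [D1 D2]; auto.
  pose proof (lyap_sum_step k) as HL; pose proof (gap_step k) as HG.
  pose proof (ec_bound k) as HE; pose proof (dc_bound k) as HD.
  pose proof (ysum_nonneg k) as HY; pose proof (wsum_nonneg k) as HW.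
  pose proof (gap_nonneg k) as HF; pose proof noise_nonneg as HN; pose proof dcoef_pos as Hd.
  assert (HH : 0 <= INR n * nsq p (havg k)) by (pose proof (nsq_nonneg p (havg k)); pos).
  assert (Hk : 0 < he ^ k) by pos.
  unfold merit in *.
  (* From here on only [1 <= q <= 2] matters: the lower bound preserves the gains of the gap
     inequality, the upper bound limits its charges to [ysum] and to the noise. *)
  set (q := Rmin 2 e8) in *.
  assert (Hq : 1 <= q <= 2) by (split; [apply Rmin_glb; lra|apply Rmin_l]).
  change e12 with (dcoef * noise).
  unfold c_eps11; change e12 with (dcoef * noise); fold noise.
  set (dd := dcoef) in *; clearbody dd.
  set (Y := ysum k) in *; set (W := wsum k) in *; set (F := gap k) in *.
  set (H := INR n * nsq p (havg k)) in *.
  set (Es := rsum p (fun l => nsq n (ec k l))) in *.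
  set (Ds := rsum p (fun l => nsq n (dc k l))) in *.
  set (N := noise) in *; clearbody q Y W F H Es Ds N.
  apply (Rmult_le_compat_l (eta + 7 / 4 * eta ^ 2)) in HE; [|assert (0 < eta ^ 2) by pos; lra].
  apply (Rmult_le_compat_l dd) in HD; [|lra].
  apply (Rmult_le_compat_l q) in HG; [|lra].
  apply (Rmult_le_compat_r Y) in T1; auto.
  apply (Rmult_le_compat_r W) in T2; auto.
  apply (Rmult_le_compat_r F) in T3; auto.
  apply (Rmult_le_compat_r H) in D1; auto.
  assert (D3 : 1 * ((eta / 2 - eta ^ 2 * Lf / 2) * H) <= q * ((eta / 2 - eta ^ 2 * Lf / 2) * H))
    by (apply Rmult_le_compat_r; [apply Rmult_le_pos|]; lra).
  assert (Q1 : q * (eta * Lf ^ 2 * Y) <= 2 * (eta * Lf ^ 2 * Y))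
    by (apply Rmult_le_compat_r; [pos|lra]).
  assert (Q2 : q * (eta / 3 * N * he ^ k) <= 2 * (eta / 3 * N * he ^ k))
    by (apply Rmult_le_compat_r; [pos|lra]).
  assert (Q3 : 1 * (eta * nu * F) <= q * (eta * nu * F))
    by (apply Rmult_le_compat_r; [pos|lra]).
  assert (Q4 : 0 <= eta * nu * F) by pos.
  assert (R1 : 0 <= eta * Lf ^ 2 * Y) by pos.
  assert (R2 : 0 <= eta ^ 2 * Lf ^ 2 * Y) by pos.
  assert (R3 : 0 <= eta ^ 2 * beta ^ 2 * rho * Y) by pos.
  assert (R4 : 0 <= eta ^ 2 * beta ^ 2 * rho ^ 2 * Y) by pos.
  assert (R5 : 0 <= eta ^ 2 * W) by pos.
  assert (R6 : 0 <= eta * N * he ^ k) by pos.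
  assert (R7 : 0 <= eta ^ 2 * N * he ^ k) by pos.
  assert (HW3 : / (2 * beta) * (/ rho2 + alpha / beta)
    = alpha / (2 * beta ^ 2) + / (2 * beta * rho2)) by (field; lra).
  rewrite HW3 in HL.
  unfold c_teps1, c_teps2, c_eps3, c_eps4 in *.
  lra.
Qed.

(** * Unrolling the recursion and the two final estimates *)

Lemma merit_bound k :
  merit k <= (1 - te) ^ k * merit 0 + (e11 + e12 * he) * geosum (1 - te) he k.
Proof.
  pose proof (teps_lt1 alpha beta eta Lf nu rho rho2 kappa2) as Hte.
  induction k as [|k IH]; [simpl; lra|].
  eapply Rle_trans; [apply merit_step|].
  apply (Rmult_le_compat_l (1 - te)) in IH; [|apply Rlt_le, Rlt_0_minus; auto].
  simpl; simpl in IH; lra.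
Qed.

Lemma merit_bound_phi be k : he < be ->
  (1 - te) * merit k <= (1 - te) ^ (k + 1) * e8 * (ysum 0 + wsum 0 + gap 0)
    + phi e11 e12 te he be k.
Proof.
  intros Hbe.
  assert (Hte : 0 < 1 - te)
    by (apply Rlt_0_minus, (teps_lt1 alpha beta eta Lf nu rho rho2 kappa2); auto).
  assert (Hte0 : 0 < te) by (apply (teps_pos alpha beta eta Lf nu rho rho2 kappa2); auto).
  pose proof noise_nonneg; pose proof dcoef_pos.
  assert (H12 : 0 <= e12) by (change e12 with (dcoef * noise); apply Rmult_le_pos; lra).
  assert (H11 : 0 <= e11).
  { unfold c_eps11; fold noise; assert (0 < eta ^ 2) by pos.
    apply Rplus_le_le_0_compat; auto; apply Rmult_le_pos; lra. }
  pose proof (merit_bound k) as Hk; pose proof (merit_le 0) as Hm0.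
  pose proof (geosum_le_phi e11 e12 te he be k) as Hphi.
  apply (Rmult_le_compat_l (1 - te)) in Hk; [|lra].
  apply (Rmult_le_compat_l ((1 - te) ^ S k)) in Hm0; [|pos].
  rewrite Nat.add_1_r; simpl in *; specialize (Hphi H11 H12 Hte0 Hte (conj Hhe Hhe1) Hbe); lra.
Qed.

Lemma consensus_gap_bound be k : he < be ->
  ysum k + gap k <= / e9 * ((1 - te) ^ (k + 1) * e8 * (ysum 0 + wsum 0 + gap 0)
    + phi e11 e12 te he be k).
Proof.
  intros Hbe; pose proof (merit_bound_phi be k Hbe); pose proof (merit_ge k).
  assert (H9 : 0 < e9) by (apply (eps9_pos alpha beta Lf rho rho2 kappa2); auto).
  apply (Rmult_le_reg_l e9); auto.
  rewrite <- Rmult_assoc, Rinv_r, Rmult_1_l by lra.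
  pose proof (gap_nonneg k); assert (0 <= e9 * gap k) by (apply Rmult_le_pos; lra); lra.
Qed.

(** The decomposition of a second moment into variance and squared bias. *)
Lemma snsq_vsub_mean k z :
  snsq n p (fun i => vsub (x i k) z) = ysum k + INR n * nsq p (vsub (xbar k) z).
Proof.
  rewrite snsq_swap; unfold ysum, nsq at 3.
  rewrite <- rsum_scal, <- rsum_plus; apply rsum_ext; intros l _.
  unfold yc, vsub; rewrite nsq_centered by auto.
  rewrite (nsq_ext n _ (fun i => x i k l + - z l * 1)) by (intros; ring).
  rewrite (nsq_plus n (fun i => x i k l) (fun _ => - z l * 1)), dotp_scal_r, nsq_scal.
  unfold dotp, nsq at 2; rewrite rsum_const.
  rewrite (rsum_ext n (fun i => x i k l * 1) (fun i => x i k l)) by (intros; ring).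
  unfold xbar, avgv; field; lra.
Qed.

Lemma projection_bound be k z : he < be -> is_proj p (favg n f) fstar (xbar k) z ->
  snsq n p (fun i => vsub (x i k) z) <=
    / e9 * (1 + / (2 * nu)) * ((1 - te) ^ (k + 1) * e8 * (ysum 0 + wsum 0 + gap 0)
      + phi e11 e12 te he be k).
Proof.
  intros Hbe Hz; pose proof (merit_bound_phi be k Hbe) as Hb; pose proof (merit_ge k) as Hm.
  assert (H9 : 0 < e9) by (apply (eps9_pos alpha beta Lf rho rho2 kappa2); auto).
  pose proof (quadratic_growth p (favg n f) (gavg n g) Lf nu fstar favg_dep HLf Hnu
    favg_descent HA2_min HA4 _ _ Hz) as Hq.
  apply (Rmult_le_compat_l (INR n)) in Hq; [|lra].
  rewrite snsq_vsub_mean.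
  pose proof (ysum_nonneg k); pose proof (gap_nonneg k).
  assert (Hg : INR n * (2 / nu * (favg n f (xbar k) - fstar)) = 2 / nu * gap k)
    by (unfold gap; ring).
  rewrite Hg in Hq.
  (* The factor 4 on the gap makes up for the constant: four times [/ (2 nu)] is the [2 / nu] of
     quadratic growth. *)
  apply Rle_trans with (/ e9 * (1 + / (2 * nu)) * (e9 * (ysum k + 4 * gap k))).
  - replace (/ e9 * (1 + / (2 * nu)) * (e9 * (ysum k + 4 * gap k))) with
      (ysum k + 2 / nu * gap k + (4 * gap k + / (2 * nu) * ysum k)) by (field; lra).
    assert (0 <= / (2 * nu) * ysum k) by pos; lra.
  - apply Rmult_le_compat_l; [|lra].
    assert (0 < / (2 * nu)) by pos; assert (0 < / e9) by (apply Rinv_0_lt_compat; auto).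
    apply Rmult_le_pos; lra.
Qed.

End Algorithm.

Theorem theorem4
  (n p : nat) (a : nat -> nat -> R)
  (f : nat -> vec -> R) (g : nat -> vec -> vec)
  (fstar Lf nu rho rho2 kappa2 alpha beta eta he be : R)
  (delta : nat -> nat -> R) (x v : nat -> nat -> vec)
  (* graph: weighted undirected graph, no self-loops *)
  (Hp : (1 <= p)%nat)
  (Ha_nonneg : forall i j, (i < n)%nat -> (j < n)%nat -> a i j >= 0)
  (Ha_sym : forall i j, (i < n)%nat -> (j < n)%nat -> a i j = a j i)
  (Ha_loop : forall i, (i < n)%nat -> a i i = 0)
  (* (A1) *)
  (HA1 : connected n a)
  (Hrho : is_largest_eig n (laplacian n a) rho)
  (Hrho2 : is_smallest_pos_eig n (laplacian n a) rho2)
  (* the f_i are functions on R^p with gradients g_i *)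
  (Hfp : forall i, (i < n)%nat -> dep_p p (f i))
  (Hgrad : forall i, (i < n)%nat -> is_gradient p (f i) (g i))
  (* (A2) *)
  (HA2_min : forall y, favg n f y >= fstar)
  (HA2_ex : exists xs, favg n f xs = fstar)
  (* (A3) *)
  (HLf : Lf > 0)
  (HA3 : forall i, (i < n)%nat -> forall y z,
      sqrt (nsq p (vsub (g i y) (g i z))) <= Lf * sqrt (nsq p (vsub y z)))
  (* (A4) *)
  (Hnu : nu > 0)
  (HA4 : forall y, / 2 * nsq p (gavg n g y) >= nu * (favg n f y - fstar))
  (* parameters of Theorem 3 *)
  (Hkappa2 : kappa2 > 1)
  (Hbeta : beta > Rmax (Rmax (c_tkappa1 Lf rho2 / (kappa2 - 1)) (c_kappa3 kappa2 rho2))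
                       (c_tkappa4 kappa2 Lf rho2))
  (Halpha : beta + c_tkappa1 Lf rho2 < alpha /\ alpha <= kappa2 * beta)
  (Heta : 0 < eta /\
          eta < Rmin (Rmin (c_teps1 alpha beta Lf rho2 / c_teps2 alpha beta Lf rho)
                           (c_eps3 alpha beta rho2 / c_eps4 beta))
                     (c_teps5 alpha beta Lf rho2 / c_teps6 alpha beta Lf rho2))
  (Hhe : 0 < he < 1)
  (Hbe : he < be < 1)
  (Hdelta : forall i k, (i < n)%nat -> 0 < delta i k <= Rpower he (INR k / 2))
  (* Algorithm 2 *)
  (Hv0 : forall l, (l < p)%nat -> rsum n (fun j => v j O l) = 0)
  (Hx : forall i k l, (i < n)%nat -> (l < p)%nat ->
      x i (S k) l = x i k l - eta * (alpha * rsum n (fun j => laplacian n a i j * x j k l)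
                                     + beta * v i k l
                                     + hatgrad p (f i) (x i k) (delta i k) l))
  (Hv : forall i k l, (i < n)%nat -> (l < p)%nat ->
      v i (S k) l = v i k l + eta * beta * rsum n (fun j => laplacian n a i j * x j k l)) :
  let delta0 := rmaxn n (fun i => delta i O) in
  let xbar := fun k => avgv n (fun i => x i k) in
  let h00 := fun i => hatgrad p (f i) (xbar O) delta0 in
  let U0 := Knsq n p (fun i => x i O)
            + Knsq n p (fun i l => v i O l + / beta * h00 i l)
            + INR n * (favg n f (xbar O) - fstar) in
  let e8 := c_eps8 alpha beta rho2 in
  let e9 := c_eps9 alpha beta rho in
  let e11 := c_eps11 n p alpha beta eta Lf rho2 in
  let e12 := c_eps12 n p alpha beta eta Lf rho2 in
  let te := c_teps alpha beta eta Lf rho rho2 nu in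
  (forall k : nat,
     snsq n p (fun i => vsub (x i k) (xbar k)) + INR n * (favg n f (xbar k) - fstar)
     <= / e9 * ((1 - te) ^ (k + 1) * e8 * U0 + phi e11 e12 te he be k))
  /\
  ((forall y : vec, exists z : vec, is_proj p (favg n f) fstar y z /\
      forall z', is_proj p (favg n f) fstar y z' -> forall l, (l < p)%nat -> z' l = z l) ->
   forall (k : nat) (z : vec), is_proj p (favg n f) fstar (xbar k) z ->
     snsq n p (fun i => vsub (x i k) z)
     <= / e9 * (1 + / (2 * nu)) * ((1 - te) ^ (k + 1) * e8 * U0 + phi e11 e12 te he be k)).
Proof.
  intros delta0 xbar0 h00 U0 e8 e9 e11 e12 te.
  assert (Hb : beta > c_kappa3 kappa2 rho2).
  { pose proof (Rmax_l (Rmax (c_tkappa1 Lf rho2 / (kappa2 - 1)) (c_kappa3 kappa2 rho2))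
      (c_tkappa4 kappa2 Lf rho2)).
    pose proof (Rmax_r (c_tkappa1 Lf rho2 / (kappa2 - 1)) (c_kappa3 kappa2 rho2)); lra. }
  destruct Halpha as [Ha _]; destruct Heta as [He Het].
  pose proof (Rlt_le_trans _ _ _ Het (Rmin_l _ _)) as Het12.
  pose proof (Rlt_le_trans _ _ _ Het (Rmin_r _ _)) as Het3.
  pose proof (Rlt_le_trans _ _ _ Het12 (Rmin_l _ _)) as Het1.
  pose proof (Rlt_le_trans _ _ _ Het12 (Rmin_r _ _)) as Het2.
  destruct (laplacian_pseudoinverse n a Ha_nonneg Ha_sym HA1 rho rho2 Hrho Hrho2)
    as [Q [HQ1 [HQ2 [HQ3 HQ4]]]].
  destruct Hhe as [Hhe0 Hhe1]; destruct Hbe as [Hbe0 _].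
  assert (Hn : (1 <= n)%nat) by (eapply laplacian_dim; eauto).
  unfold U0; rewrite !Knsq_centered by auto.
  split.
  - intros k; unfold xbar0; rewrite <- ysum_snsq.
    eapply (consensus_gap_bound n p a f g fstar Lf nu rho rho2 kappa2 alpha beta eta he delta x v);
      eauto.
  - intros _ k z Hz.
    eapply (projection_bound n p a f g fstar Lf nu rho rho2 kappa2 alpha beta eta he delta x v);
      eauto.
Qed.
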